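(* Let $p$ be a prime and $d_1\geq d_2\geq d_3\geq 0$ integers. Let $|\mathbf{AbSol}(p^{d_1},p^{d_2},p^{d_3})|$ denote the number of isomorphism classes in $\mathbf{AbSol}(p^{d_1},p^{d_2},p^{d_3})$. Then $$|\mathbf{AbSol}(p^{d_1},p^{d_2},p^{d_3})|=\begin{cases} p^{d_1}\bigl(1+(-d_1+d_2+d_3)(1-p^{-1})\bigr)& \text{if } d_1<d_2+d_3,\\ p^{d_2+d_3} & \text{if } d_1\geq d_2+d_3.\end{cases}$$ In particular, for $d\ge 0$ the number of isomorphism classes of indecomposable involutive solutions with abelian permutation group, of size $p^d$ and multipermutation level at most $3$, is $$\sum_{\substack{d_1\geq d_2\geq d_3\geq 0\\ d_1+d_2+d_3=d}}|\mathbf{AbSol}(p^{d_1},p^{d_2},p^{d_3})|.$$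
   Context: A solution is a pair $(X,r)$ with $X$ a nonempty set and $r:X^2\to X^2$ a bijection, $r(x,y)=(\sigma_x(y),\tau_y(x))$, satisfying the braid equation $(r\times \mathrm{id})(\mathrm{id}\times r)(r\times \mathrm{id})=(\mathrm{id}\times r)(r\times \mathrm{id})(\mathrm{id}\times r)$ with all $\sigma_x,\tau_x$ bijective. It is involutive if $r^2=\mathrm{id}$; indecomposable if the group generated by all $\sigma_x,\tau_x$ is transitive on $X$; its permutation group is $\langle(\sigma_x,\tau_x^{-1})\mid x\in X\rangle$. Isomorphisms $(X,r)\to(Y,s)$ are bijections $f$ with $(f\times f)r=s(f\times f)$. $\mathrm{Ret}(X,r)$ is the induced solution on $X/{\sim}$, where $x\sim y$ iff $\sigma_x=\sigma_y$ and $\tau_x=\tau_y$; $\mathrm{Ret}^0(X,r)=(X,r)$ and $\mathrm{Ret}^{n+1}(X,r)=\mathrm{Ret}(\mathrm{Ret}^n(X,r))$. The multipermutation level is the smallest $n\ge 0$ with $|\mathrm{Ret}^n(X,r)|=1$, if it exists. $\mathbf{AbSol}(m_1,m_2,m_3)$ consists of the finite indecomposable involutive solutions $(X,r)$ with abelian permutation group such that $|\mathrm{Ret}^{i-1}(X,r)|/|\mathrm{Ret}^{i}(X,r)|=m_i$ for $i=1,2,3$ and $|\mathrm{Ret}^3(X,r)|=1$. *)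

(* Defs.v *)
From HB Require Import structures.
From mathcomp Require Import all_boot all_fingroup all_order all_algebra.
From mathcomp Require Import generic_quotient.
From mathcomp Require classical_sets.

Set Implicit Arguments.
Unset Strict Implicit.
Unset Printing Implicit Defensive.

Section SetTheoreticSolutions.

Variables (X : Type) (r : X * X -> X * X).

(* r (x, y) = (sigma_x y, tau_y x) *)
Definition sigma (x y : X) : X := (r (x, y)).1.
Definition tau (y x : X) : X := (r (x, y)).2.

(* r x id and id x r on X * X * X = (X * X) * X *)
Definition r_id (t : X * X * X) : X * X * X := (r t.1, t.2).
Definition id_r (t : X * X * X) : X * X * X :=
  let q := r (t.1.2, t.2) in (t.1.1, q.1, q.2).

Definition braid_equation : Prop :=
  forall t, r_id (id_r (r_id t)) = id_r (r_id (id_r t)).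

Record is_solution : Prop := IsSolution {
  sol_nonempty : inhabited X;
  sol_bij : bijective r;
  sol_braid : braid_equation;
  sol_sigma_bij : forall x, bijective (sigma x);
  sol_tau_bij : forall x, bijective (tau x) }.

End SetTheoreticSolutions.

Record fin_solution := FinSolution {
  carrier :> finType;
  smap : carrier * carrier -> carrier * carrier;
  fin_solutionP : is_solution smap }.

Section FiniteSolutions.

Variable S : fin_solution.
Local Notation r := (@smap S).

Lemma sigma_inj (x : S) : injective (sigma r x).
Proof. exact/bij_inj/(sol_sigma_bij (fin_solutionP S)). Qed.

Lemma tau_inj (y : S) : injective (tau r y).
Proof. exact/bij_inj/(sol_tau_bij (fin_solutionP S)). Qed.

Definition sigma_perm (x : S) : {perm S} := perm (@sigma_inj x).
Definition tau_perm (x : S) : {perm S} := perm (@tau_inj x).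

Definition involutive_sol : Prop := forall u, r (r u) = u.

(* The product of {perm S} is composition in the reverse order; this changes
   neither the subset generated by a set of permutations, nor transitivity, nor
   commutativity. *)
Definition indecomposable : bool :=
  [transitive <<[set sigma_perm x | x : S] :|: [set tau_perm x | x : S]>>%g,
     on [set: S] | 'P].

Definition permutation_group : {group {perm S} * {perm S}} :=
  <<[set (sigma_perm x, (tau_perm x)^-1%g) | x : S]>>%G.

Definition ret_rel : rel S :=
  fun x y => (sigma_perm x == sigma_perm y) && (tau_perm x == tau_perm y).

Lemma ret_rel_refl : reflexive ret_rel.
Proof. by move=> x; rewrite /ret_rel !eqxx. Qed.

Lemma ret_rel_sym : symmetric ret_rel.
Proof.
by move=> x y; rewrite /ret_rel [sigma_perm x == _]eq_sym [tau_perm x == _]eq_sym.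
Qed.

Lemma ret_rel_trans : transitive ret_rel.
Proof.
by move=> y x z /andP[/eqP xy1 /eqP xy2] /andP[/eqP yz1 /eqP yz2];
  rewrite /ret_rel xy1 xy2 yz1 yz2 !eqxx.
Qed.

Canonical ret_equiv := EquivRel ret_rel ret_rel_refl ret_rel_sym ret_rel_trans.

Definition ret_type := {eq_quot ret_equiv}%qT.
HB.instance Definition _ := Choice.on ret_type.
HB.instance Definition _ := Quotient.on ret_type.
HB.instance Definition _ := EqQuotient.on ret_type.
HB.instance Definition _ : isCountable ret_type := CanIsCountable (@reprK _ ret_type).
HB.instance Definition _ : isFinite ret_type := CanIsFinite (@reprK _ ret_type).

Definition ret_class (x : S) : ret_type := (\pi_ret_type x)%qT.

(* Defined through representatives; ret_mapE states that this is the map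
   induced by r on the quotient. *)
Definition ret_map (u : ret_type * ret_type) : ret_type * ret_type :=
  let v := r (repr u.1, repr u.2) in (ret_class v.1, ret_class v.2).

Lemma ret_classP (x y : S) :
  reflect (sigma r x =1 sigma r y /\ tau r x =1 tau r y)
          (ret_class x == ret_class y).
Proof.
have -> : (ret_class x == ret_class y) = ret_rel x y by rewrite piE.
apply: (iffP andP) => -[].
  move=> /eqP/permP e1 /eqP/permP e2; split=> z.
    by have := e1 z; rewrite !permE.
  by have := e2 z; rewrite !permE.
move=> e1 e2; split; apply/eqP/permP=> z; rewrite !permE.
  exact: e1.
exact: e2.
Qed.

Lemma ret_class_repr (a : ret_type) : ret_class (repr a) = a.
Proof. exact: reprK. Qed.

Lemma sigma_braid (x y z : S) :
  sigma r x (sigma r y z) = sigma r (sigma r x y) (sigma r (tau r y x) z).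
Proof.
have /(congr1 (fun t => t.1.1)) := sol_braid (fin_solutionP S) (x, y, z).
by rewrite /r_id /id_r /sigma /tau /=; case: (r (x, y)) => a b /= ->.
Qed.

Lemma tau_braid (x y z : S) :
  tau r z (tau r y x) = tau r (tau r z y) (tau r (sigma r y z) x).
Proof.
have /(congr1 (fun t => t.2)) := sol_braid (fin_solutionP S) (x, y, z).
by rewrite /r_id /id_r /sigma /tau /=; case: (r (x, y)) => a b /= ->.
Qed.

Lemma sigma_surj (x y : S) : exists z, sigma r x z = y.
Proof. by have [g _ gK] := sol_sigma_bij (fin_solutionP S) x; exists (g y). Qed.

Lemma tau_surj (x y : S) : exists z, tau r x z = y.
Proof. by have [g _ gK] := sol_tau_bij (fin_solutionP S) x; exists (g y). Qed.

Lemma ret_class_sigma_tau (x x' y y' : S) :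
  ret_class x = ret_class x' -> ret_class y = ret_class y' ->
  ret_class (sigma r x y) = ret_class (sigma r x' y') /\
  ret_class (tau r y x) = ret_class (tau r y' x').
Proof.
move=> /eqP/ret_classP[sx tx] /eqP/ret_classP[sy ty].
rewrite sx -ty; split; apply/eqP/ret_classP; split=> z.
- have [w <-] := sigma_surj (tau r y x') z.
  by rewrite -sigma_braid ty -sigma_braid sy.
- apply: (@tau_inj (tau r y x')).
  by rewrite -tau_braid (ty x') -tau_braid ty.
- apply: (@sigma_inj (sigma r x y)).
  by rewrite -sigma_braid (sx y) -sigma_braid sx.
- have [w <-] := tau_surj (sigma r x y) z.
  by rewrite -tau_braid sx -tau_braid tx.
Qed.

Lemma ret_mapE (x y : S) :
  ret_map (ret_class x, ret_class y) =
    (ret_class (r (x, y)).1, ret_class (r (x, y)).2).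
Proof.
rewrite /ret_map /=.
by have [-> ->] := ret_class_sigma_tau (ret_class_repr (ret_class x))
                                       (ret_class_repr (ret_class y)).
Qed.

Lemma surj_bij (T : finType) (f : T -> T) :
  (forall y, exists x, f x = y) -> bijective f.
Proof.
move=> f_surj; have f_inv y : {x | f x == y}.
  by apply: sigW; have [x <-] := f_surj y; exists x.
have gK : cancel (fun y => sval (f_inv y)) f by move=> y; apply/eqP/(svalP (f_inv y)).
by apply: (bij_can_bij (injF_bij (can_inj gK)) gK).
Qed.

Lemma ret_solution : is_solution ret_map.
Proof.
split.
- by have [x] := sol_nonempty (fin_solutionP S); constructor; exact: ret_class x.
- apply: surj_bij => -[a b].
  have [g _ gK] := sol_bij (fin_solutionP S).
  have [xy E] : exists xy, r xy = (repr a, repr b) by exists (g (repr a, repr b)).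
  exists (ret_class xy.1, ret_class xy.2).
  by rewrite ret_mapE -surjective_pairing E /= !ret_class_repr.
- pose c3 (t : S * S * S) := (ret_class t.1.1, ret_class t.1.2, ret_class t.2).
  have r_idE t : r_id ret_map (c3 t) = c3 (r_id r t).
    by case: t => [[x y] z]; rewrite /c3 /r_id /= ret_mapE.
  have id_rE t : id_r ret_map (c3 t) = c3 (id_r r t).
    by case: t => [[x y] z]; have := ret_mapE y z; rewrite /c3 /ret_map /= /id_r /= => -[-> ->].
  move=> [[a b] c]; have -> : (a, b, c) = c3 (repr a, repr b, repr c).
    by rewrite /c3 /= !ret_class_repr.
  by rewrite !(r_idE, id_rE) (sol_braid (fin_solutionP S)).
- move=> a; apply: surj_bij => b; have [y yb] := sigma_surj (repr a) (repr b).
  exists (ret_class y); rewrite -[a]ret_class_repr -[b]ret_class_repr -yb.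
  by rewrite {1}/sigma ret_mapE.
- move=> a; apply: surj_bij => b; have [y yb] := tau_surj (repr a) (repr b).
  exists (ret_class y); rewrite -[a]ret_class_repr -[b]ret_class_repr -yb.
  by rewrite {1}/tau ret_mapE.
Qed.

Definition Ret : fin_solution := FinSolution ret_solution.

End FiniteSolutions.

Definition Ret_iter (n : nat) (S : fin_solution) : fin_solution := iter n Ret S.

Definition has_mpl (S : fin_solution) (n : nat) : Prop :=
  #|Ret_iter n S| = 1 /\ forall k, k < n -> #|Ret_iter k S| <> 1.

Definition isomorphic (S T : fin_solution) : Prop :=
  exists2 f : S -> T, bijective f &
    forall x y, smap (f x, f y) = (f (smap (x, y)).1, f (smap (x, y)).2).

Definition has_iso_classes (P : fin_solution -> Prop) (k : nat) : Prop :=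
  exists s : 'I_k -> fin_solution,
    [/\ forall i, P (s i),
        forall i j, isomorphic (s i) (s j) -> i = j &
        forall S, P S -> exists i, isomorphic S (s i)].

(* Equal to 0 if P has infinitely many isomorphism classes; so n_iso_classes P = k
   with k > 0 does imply has_iso_classes P k. *)
Definition n_iso_classes (P : fin_solution -> Prop) : nat :=
  classical_sets.xget 0 (has_iso_classes P).

Definition indecomposable_involutive_abelian (S : fin_solution) : Prop :=
  [/\ indecomposable S, involutive_sol S & abelian (permutation_group S)].

Definition ret_ratio (i : nat) (S : fin_solution) : rat :=
  (#|Ret_iter i.-1 S|%:R / #|Ret_iter i S|%:R)%R.

Definition AbSol (m1 m2 m3 : nat) (S : fin_solution) : Prop :=
  [/\ indecomposable_involutive_abelian S,
      ret_ratio 1 S = m1%:R%R, ret_ratio 2 S = m2%:R%R, ret_ratio 3 S = m3%:R%R &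
      #|Ret_iter 3 S| = 1].

Definition AbSol_size_mpl_le3 (n : nat) (S : fin_solution) : Prop :=
  [/\ indecomposable_involutive_abelian S, #|S| = n &
      exists2 l, l <= 3 & has_mpl S l].

(* Main.v *)
From HB Require Import structures.
Require Import Defs.
From mathcomp Require Import all_boot all_fingroup all_order all_algebra.
From mathcomp Require Import cyclic zify ring boolp.

(** Every solution in question is a quotient of a universal one: the solution on
Z^3 with sigma_P(Q) = Q + lam(P), where lam(x, y, z) = (1, x, x(x+1)/2 + y).
Indeed the group generated by the sigma's is abelian and regular, so that the
solution is a map l on an abelian group satisfying
l(x) + l(y - l(x)) = l(y) + l(x - l(y)), and vanishing of the third retraction
forces l to be the above quadratic map in suitable generators E, c, b.

The lam-invariant sublattices of finite index have the Hermite form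
<(0,0,m3), (0,m2,-s), (m1,-u,-v)> with m3 | m2 | m1 and
u = (m1/m2)(s + m2(m2+1)/2) mod m3, and the retraction of the quotient for
(m1,m2,m3) is a quotient of the same kind for (m2,m3,1).  Isomorphisms come from a
change of the base point only; this fixes s mod m3 and u mod m2, and moves v by
the multiples of (m1/m2) s modulo m3.  Hence there are
(m2/m3) * \sum_(s < m3) gcd(m3, (m1/m2) s) classes, a sum of Pillai type. *)

Set Implicit Arguments.
Unset Strict Implicit.
Unset Printing Implicit Defensive.

Import GRing.Theory Num.Theory.
Local Open Scope ring_scope.

(** * The universal solution on Z^3 *)

Lemma mulrzS (M : zmodType) (x : M) (n : nat) : x *~ n.+1 = x *~ n + x.
Proof. by rewrite -addn1 PoszD mulrzDr. Qed.

Lemma mulrzSN (M : zmodType) (x : M) (n : nat) : x *~ (- n.+1%:Z) = x *~ (- n%:Z) - x.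
Proof. by rewrite !mulrNz mulrzS opprD. Qed.

Notation Z3 := (int * int * int)%type.

Definition tri (x : int) : int := (x * (x + 1) %/ 2)%Z.

Lemma tri_double x : 2 * tri x = x * (x + 1).
Proof.
rewrite /tri; suff : (2 %| x * (x + 1))%Z by move=> /dvdzP[q ->]; rewrite mulzK // mulrC.
have [q [->|->]] : exists q : int, x = q * 2 \/ x = q * 2 + 1.
- by exists (x %/ 2)%Z; lia.
- by rewrite -mulrA mulrCA dvdz_mulr.
- by apply/dvdzP; exists ((q * 2 + 1) * (q + 1)); ring.
Qed.

Lemma triD x y : tri (x + y) = tri x + tri y + x * y.
Proof. by apply: (@mulfI _ 2) => //; rewrite !mulrDr !tri_double; ring. Qed.

Lemma tri0 : tri 0 = 0. Proof. by []. Qed.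
Lemma tri1 : tri 1 = 1. Proof. by []. Qed.

Definition lam (P : Z3) : Z3 := (1, P.1.1, tri P.1.1 + P.1.2).

Lemma Z3P (P Q : Z3) : P.1.1 = Q.1.1 -> P.1.2 = Q.1.2 -> P.2 = Q.2 -> P = Q.
Proof. by case: P Q => [[x y] z] [[x' y'] z'] /= -> -> ->. Qed.

Lemma Z3D (P Q : Z3) : P + Q = (P.1.1 + Q.1.1, P.1.2 + Q.1.2, P.2 + Q.2).
Proof. by []. Qed.

Lemma Z3N (P : Z3) : - P = (- P.1.1, - P.1.2, - P.2).
Proof. by []. Qed.

Definition Z3E := (Z3D, Z3N).

Lemma lam_cocycle P Q : lam P + lam (Q - lam P) = lam Q + lam (P - lam Q).
Proof. by rewrite /lam !Z3E; apply: Z3P => /=; rewrite ?triD; ring. Qed.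

(** The three vectors are the values of [lam] at [0], [(1, 0, 0)] and [(-1, 0, 0)]. Naming just
    these lets [isomorphic_presents] reach each generator from the base point. *)
Lemma Z3_generated (T : Z3 -> Prop) :
  (forall P Q, T P -> T Q -> T (P - Q)) ->
  T (1, 0, 0) -> T (1, 1, 1) -> T (1, -1, 0) -> forall P, T P.
Proof.
move=> TB TE TEp TEm.
have T0 : T 0 by rewrite -(subrr (1, 0, 0)); apply: TB.
have TD P Q : T P -> T Q -> T (P + Q).
  by move=> TP TQ; rewrite -[Q in _ + Q]opprK -[- Q]sub0r; apply/TB/TB.
have Tz P : T P -> forall n : int, T (P *~ n).
  move=> TP; elim=> [|n IHn|n IHn]; first by rewrite mulr0z.
    by rewrite mulrzS; apply: TD.
  by rewrite mulrzSN; apply: TB.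
have Tc := TB _ _ TE TEm; have TB' := TB _ _ (TB _ _ TEp TE) Tc.
case=> [[x y] z].
suff -> : ((x, y, z) : Z3) = (1, 0, 0) *~ x + ((1, 0, 0) - (1, -1, 0)) *~ y
   + ((1, 1, 1) - (1, 0, 0) - ((1, 0, 0) - (1, -1, 0))) *~ z.
  by apply: (TD _ _ (TD _ _ (Tz _ TE x) (Tz _ Tc y)) (Tz _ TB' z)).
have zE (P : Z3) n : P *~ n = (P.1.1 * n, P.1.2 * n, P.2 * n).
  case: P => [[a b] c]; elim: n => [|n IHn|n IHn].
  - by rewrite mulr0z !mulr0.
  - by rewrite mulrzS IHn !Z3E; apply: Z3P => /=; ring.
  - by rewrite mulrzSN IHn !Z3E; apply: Z3P => /=; ring.
by rewrite !zE !Z3E; apply: Z3P => /=; ring.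
Qed.

Lemma Z3_lam_generated (T : Z3 -> Prop) :
  (forall P Q, T P -> T Q -> T (P - Q)) -> (forall P, T (lam P)) -> forall P, T P.
Proof.
move=> TB Tl; apply: Z3_generated => //; first exact: (Tl 0).
  exact: (Tl (1, 0, 0)).
exact: (Tl (-1, 0, 0)).
Qed.

(** * Solutions presented as quotients of Z^3 *)

(** [S] is the universal solution modulo the subgroup [R]. The second component in [pres_map] is
    forced by involutivity: it is the point that translation by [lam (Q + lam P)] takes to [P]. *)
Record presents (R : Z3 -> Prop) (S : fin_solution) (phi : Z3 -> S) : Prop := Presents {
  pres_surj : forall a, exists P, phi P = a;
  pres_ker : forall P Q, phi P = phi Q <-> R (P - Q);
  pres_map : forall P Q,
    smap (phi P, phi Q) = (phi (Q + lam P), phi (P - lam (Q + lam P))) }.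

Section Presented.

Variables (R : Z3 -> Prop) (S : fin_solution) (phi : Z3 -> S).
Hypothesis pS : presents R phi.

Lemma pres_sigma P Q : sigma (@smap S) (phi P) (phi Q) = phi (Q + lam P).
Proof. by rewrite /sigma (pres_map pS). Qed.

Lemma pres_tau P Q : tau (@smap S) (phi Q) (phi P) = phi (P - lam (Q + lam P)).
Proof. by rewrite /tau (pres_map pS). Qed.

Lemma presD P Q V : phi P = phi Q -> phi (P + V) = phi (Q + V).
Proof. by move/(pres_ker pS)=> h; apply/(pres_ker pS); rewrite opprD addrACA subrr addr0. Qed.

Lemma pres_relE P : R P <-> phi P = phi 0.
Proof. by rewrite -[P in R P]subr0; symmetry; exact: (pres_ker pS). Qed.

Lemma pres_relB P Q : R P -> R Q -> R (P - Q).
Proof. by move=> /pres_relE hP /pres_relE hQ; apply/(pres_ker pS); rewrite hP hQ. Qed.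

Lemma pres_rel_lam P V : R V -> R (lam (P + V) - lam P).
Proof.
move=> /pres_relE hV; apply/(pres_ker pS).
have /(congr1 (fun a => sigma (@smap S) a (phi 0))) : phi (P + V) = phi P.
  by rewrite addrC -[in RHS](add0r P); apply: presD.
by rewrite !pres_sigma !add0r.
Qed.

(** Only [P.1.1] survives from [P] in the subtracted vector, so the tau's are explicit maps that
    visibly commute and can be inverted by hand. *)
Lemma tau_lamE P Q : P - lam (Q + lam P) =
  P - (1, Q.1.1 + 1, tri (Q.1.1 + 1) + Q.1.2 + P.1.1).
Proof. by rewrite /lam !Z3E; apply: Z3P => /=; ring. Qed.

Lemma pres_involutive : involutive_sol S.
Proof.
move=> [a b]; have [P <-] := pres_surj pS a; have [Q <-] := pres_surj pS b.
by rewrite !(pres_map pS) !(subrK, addrK, subKr).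
Qed.

Lemma pres_abelian : abelian (permutation_group S).
Proof.
rewrite abelian_gen; apply/centsP=> _ /imsetP[a _ ->] _ /imsetP[b _ ->].
have [P <-] := pres_surj pS a; have [Q <-] := pres_surj pS b.
congr (_, _).
  apply/permP=> c; have [V <-] := pres_surj pS c.
  by rewrite !permM !permE !pres_sigma addrAC.
rewrite /= -!invMg; congr (_^-1)%g.
apply/permP=> c; have [V <-] := pres_surj pS c.
rewrite !permM !permE !pres_tau !tau_lamE; congr phi.
by rewrite !Z3E; apply: Z3P => /=; ring.
Qed.

Lemma pres_indecomposable : indecomposable S.
Proof.
rewrite /indecomposable; set G := <<_>>%g.
apply/imsetP; exists (phi 0) => //.
apply/esym/eqP; rewrite eqEsubset subsetT /=; apply/subsetP=> a _.
have [P <-] := pres_surj pS a.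
(* The translations induced by elements of [G] form a subgroup of Z^3 containing every [lam P],
   hence everything. *)
have [g gG hg] : exists2 g, g \in G & forall Q, g (phi Q) = phi (Q + P).
  move: P; apply: Z3_lam_generated => [P Q [g gG hg] [h hG hh] | P].
    exists (g * h^-1)%g; first by rewrite groupM ?groupV.
    by move=> V; rewrite permM hg; apply: (canLR (permK h)); rewrite hh addrA subrK.
  exists (sigma_perm (phi P)); last by move=> Q; rewrite permE pres_sigma.
  by apply: mem_gen; rewrite inE imset_f.
by apply/imsetP; exists g => //=; rewrite /aperm hg add0r.
Qed.

Lemma pres_class : indecomposable_involutive_abelian S.
Proof.
by split; [exact: pres_indecomposable | exact: pres_involutive | exact: pres_abelian].
Qed.

End Presented.

(** * Change of base point and isomorphisms *)

(* P |-> P0 + rebase P0 P is the endomorphism of the universal solution that moves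
   the base point 0 to P0, see rebase_lam. *)
Definition rebase (P0 P : Z3) : Z3 :=
  (P.1.1, P0.1.1 * P.1.1 + P.1.2,
   (tri P0.1.1 + P0.1.2) * P.1.1 + 2 * P0.1.1 * P.1.2 + P.2).

Lemma rebaseB P0 P Q : rebase P0 (P - Q) = rebase P0 P - rebase P0 Q.
Proof. by rewrite /rebase !Z3E; apply: Z3P => /=; ring. Qed.

Lemma rebaseD P0 P Q : rebase P0 (P + Q) = rebase P0 P + rebase P0 Q.
Proof. by rewrite /rebase !Z3E; apply: Z3P => /=; ring. Qed.

Lemma rebase0 P0 : rebase P0 0 = 0.
Proof. by rewrite /rebase; apply: Z3P => /=; rewrite ?mulr0 ?addr0. Qed.

Lemma rebase_lam P0 P : lam (P0 + rebase P0 P) = rebase P0 (lam P).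
Proof. by rewrite /lam /rebase !Z3E; apply: Z3P => /=; rewrite ?triD; ring. Qed.

Lemma rebase_surj P0 Q : exists P, rebase P0 P = Q.
Proof.
exists (Q.1.1, Q.1.2 - P0.1.1 * Q.1.1,
  Q.2 - (tri P0.1.1 + P0.1.2) * Q.1.1 - 2 * P0.1.1 * (Q.1.2 - P0.1.1 * Q.1.1)).
by rewrite /rebase; apply: Z3P => /=; ring.
Qed.

Lemma surj_card_bij (A B : finType) (f : A -> B) :
  (forall b, exists a, f a = b) -> #|A| = #|B| -> bijective f.
Proof.
move=> f_surj cAB; have [g gK] := choice f_surj.
by apply: (bij_can_bij (inj_card_bij (can_inj gK) _) gK); rewrite cAB.
Qed.

Section Isomorphisms.

Variables (R R' : Z3 -> Prop) (S T : fin_solution) (phi : Z3 -> S) (psi : Z3 -> T).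
Hypotheses (pS : presents R phi) (pT : presents R' psi).

(** One inclusion of relations suffices: the induced map is surjective because [rebase P0] is, and
    the sizes agree. *)
Lemma presents_isomorphic P0 :
  #|S| = #|T| -> (forall P, R P -> R' (rebase P0 P)) -> isomorphic S T.
Proof.
move=> cST RR'; have [g gK] := choice (pres_surj pS).
pose f a := psi (P0 + rebase P0 (g a)).
have fE P : f (phi P) = psi (P0 + rebase P0 P).
  apply/(pres_ker pT); rewrite opprD addrACA subrr add0r -rebaseB.
  by apply/RR'/(pres_ker pS); rewrite gK.
exists f; first apply: surj_card_bij => // b.
  have [Q <-] := pres_surj pT b; have [P hP] := rebase_surj P0 (Q - P0).
  by exists (phi P); rewrite fE hP addrC subrK.
move=> a b; have [P <-] := pres_surj pS a; have [Q <-] := pres_surj pS b.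
rewrite (pres_map pS) /= !fE (pres_map pT).
by rewrite rebaseB -!rebase_lam !rebaseD -!rebase_lam !addrA.
Qed.

(** An isomorphism respects every sigma, so its values at [W] and at [P] determine those at
    [P + lam W] and [P - lam W]. Starting from [0], this reaches all generators, and [f] must be the
    change of base point to [P0]. *)
Lemma isomorphic_presents f P0 : bijective f ->
    (forall x y, smap (f x, f y) = (f (smap (x, y)).1, f (smap (x, y)).2)) ->
    f (phi 0) = psi P0 ->
  forall P, R P <-> R' (rebase P0 P).
Proof.
move=> f_bij fM f0.
have fS a b : f (sigma (@smap S) a b) = sigma (@smap T) (f a) (f b).
  by rewrite /sigma fM.
suff fE P : f (phi P) = psi (P0 + rebase P0 P).
  move=> P; rewrite (pres_relE pS) -[rebase P0 P](addKr P0) addrC.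
  rewrite -(pres_ker pT) -fE -f0; split=> [-> //|]; exact: bij_inj.
(* [T' V] says that agreement with the base change propagates along [V] and [- V]. *)
pose T' V := forall P, f (phi P) = psi (P0 + rebase P0 P) ->
   f (phi (P + V)) = psi (P0 + rebase P0 (P + V)) /\
   f (phi (P - V)) = psi (P0 + rebase P0 (P - V)).
have T'0 : (forall V, T' V) -> f (phi P) = psi (P0 + rebase P0 P).
  by move=> /(_ P 0); rewrite !add0r => -[] //; rewrite rebase0 addr0.
have T'lam W : f (phi W) = psi (P0 + rebase P0 W) -> T' (lam W).
  move=> hP Q hQ; split.
    by rewrite -(pres_sigma pS) fS hP hQ (pres_sigma pT) rebaseD rebase_lam addrA.
  apply: (@sigma_inj T (f (phi W))).
  rewrite -fS (pres_sigma pS) subrK hQ hP (pres_sigma pT).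
  by rewrite rebaseB rebase_lam addrA subrK.
have h0 : f (phi 0) = psi (P0 + rebase P0 0) by rewrite rebase0 addr0.
have [hp hm] := T'lam 0 h0 0 h0.
apply: T'0; apply: Z3_generated => [V W hV hW Q hQ| | |].
- have [h1 h2] := hV Q hQ; split.
    by have [_] := hW _ h1; rewrite addrA.
  by have [] := hW _ h2; rewrite opprB addrA addrAC.
- exact: T'lam h0.
- exact: T'lam hp.
- exact: T'lam hm.
Qed.

End Isomorphisms.

(** * Sublattices of Z^3 in Hermite form *)

Definition lattice (m1 m2 m3 : nat) (s u v : int) (P : Z3) : Prop :=
  exists q q' q'' : int,
    P = (q * m1, q' * m2 - q * u, q'' * m3 - q' * s - q * v).

(** Here [k] is [m1 / m2], [j] is [m2 / m3], and [w] turns the congruence for [u] modulo [m3] into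
    an equation; [s], [w] and [v] become the parameters to be counted. *)
Record admissible (m1 m2 m3 : nat) (s u : int) : Prop := Admissible {
  adm_pos : (0 < m3)%N;
  adm_mul : exists (k j : nat) (w : int),
    [/\ (0 < j)%N, (0 < k)%N, m2 = (j * m3)%N, m1 = (k * m2)%N &
        u = k%:Z * (s + tri m2) + w * m3%:Z] }.

Lemma tri_mul (a b : int) : tri (a * b) = a * tri b + tri (a - 1) * b ^+ 2.
Proof.
apply: (@mulfI _ 2) => //.
have -> : 2 * (a * tri b + tri (a - 1) * b ^+ 2) =
    a * (2 * tri b) + 2 * tri (a - 1) * b ^+ 2 by ring.
by rewrite !tri_double; ring.
Qed.

Lemma zord_subproof (m : nat) (x : int) : (0 < m)%N -> (`|(x %% m)%Z| < m)%N.
Proof. by move=> ?; lia. Qed.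

Definition zord m (m_gt0 : (0 < m)%N) x : 'I_m := Ordinal (zord_subproof x m_gt0).

Lemma mul_small (q : int) (m a b : nat) : q * m = a%:Z - b%:Z -> (a < m)%N -> (b < m)%N -> q = 0.
Proof. by move=> e am bm; case: (ltrgtP q 0) => // hq; nia. Qed.

Section Lattice.

Variables (m1 m2 m3 : nat) (s u v : int).
Hypotheses (m1_gt0 : (0 < m1)%N) (m2_gt0 : (0 < m2)%N) (m3_gt0 : (0 < m3)%N).
Local Notation L := (lattice m1 m2 m3 s u v).

Lemma latticeB P Q : L P -> L Q -> L (P - Q).
Proof.
move=> [a [a' [a'' ->]]] [b [b' [b'' ->]]]; exists (a - b), (a' - b'), (a'' - b'').
by rewrite !Z3E; apply: Z3P => /=; ring.
Qed.

Local Notation box := ('I_m1 * 'I_m2 * 'I_m3)%type.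

(** Reduction by the three generators in turn: each quotient shifts the later coordinates, and the
    box of remainders is a fundamental domain. *)
Definition lattice_nf (P : Z3) : box :=
  let y := P.1.2 + (P.1.1 %/ m1)%Z * u in
  (zord m1_gt0 P.1.1, zord m2_gt0 y,
   zord m3_gt0 (P.2 + (P.1.1 %/ m1)%Z * v + (y %/ m2)%Z * s)).

Definition box_val (a : box) : Z3 := (Posz a.1.1, Posz a.1.2, Posz a.2).

Lemma lattice_nfP P : L (P - box_val (lattice_nf P)).
Proof.
case: P => [[x y] z]; rewrite /lattice_nf /box_val /=.
set q := (x %/ m1)%Z; set q' := ((y + q * u) %/ m2)%Z.
set z' := z + q * v + q' * s.
exists q, q', (z' %/ m3)%Z; rewrite !Z3E; apply: Z3P => /=.
- rewrite {1}(divz_eq x m1) -/q; lia.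
- have := divz_eq (y + q * u) m2; rewrite -/q'; lia.
- have := divz_eq z' m3; rewrite {1}/z'; lia.
Qed.

Lemma box_val_inj a b : L (box_val a - box_val b) -> a = b.
Proof.
case: a b => [[a a'] a''] [[b b'] b''] [q [q' [q'']]].
rewrite /box_val !Z3E /= => -[e1 e2 e3].
have q0 : q = 0 by apply: (mul_small (esym e1)).
have q'0 : q' = 0.
  by apply: (@mul_small q' m2 a' b') => //; rewrite -[LHS]subr0 -[0](mul0r u) -q0 -e2.
have q''0 : q'' = 0.
  by apply: (@mul_small q'' m3 a'' b'') => //; rewrite e3 q0 q'0; ring.
move: e1 e2 e3; rewrite q0 q'0 q''0 => e1 e2 e3.
by congr (_, _, _); apply: val_inj => /=; lia.
Qed.

Lemma lattice_nf_ker P Q : lattice_nf P = lattice_nf Q <-> L (P - Q).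
Proof.
have hP := lattice_nfP P; have hQ := lattice_nfP Q; split=> h.
  have := latticeB hP hQ; rewrite h.
  by rewrite opprB addrA subrK.
apply: box_val_inj; have := latticeB hQ (latticeB hP h).
by congr L; rewrite !Z3E; apply: Z3P => /=; ring.
Qed.

Lemma lattice_nf_surj a : exists P, lattice_nf P = a.
Proof.
exists (box_val a); apply: box_val_inj.
(* This negates [h] through [latticeB], as [(h - h) - h]. *)
have h := lattice_nfP (box_val a); have := latticeB (latticeB h h) h.
by congr L; rewrite !Z3E; apply: Z3P => /=; ring.
Qed.

Lemma card_box : #|{: box}| = (m1 * m2 * m3)%N.
Proof. by rewrite !card_prod !card_ord. Qed.

Lemma presents_card (S : fin_solution) (phi : Z3 -> S) : presents L phi -> #|S| = (m1 * m2 * m3)%N.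
Proof.
move=> pS; have [g gK] := choice (pres_surj pS).
rewrite -card_box; apply: (bij_eq_card (f := fun a => lattice_nf (g a))).
have [h hK] := choice lattice_nf_surj.
exists (fun b => phi (h b)) => [a | b]; first rewrite -[RHS]gK.
  by apply/(pres_ker pS)/lattice_nf_ker; rewrite hK.
by rewrite -[RHS]hK; apply/lattice_nf_ker/(pres_ker pS).
Qed.

End Lattice.

(** * Quotients of the universal solution by invariant subgroups *)

Section QuotientSolution.

Variables (C : finType) (R : Z3 -> Prop) (f : Z3 -> C).
Hypotheses (f_surj : forall c, exists P, f P = c)
  (f_ker : forall P Q, f P = f Q <-> R (P - Q))
  (R_lam : forall P V, R V -> R (lam (P + V) - lam P)).

Lemma quotient_solution :
  exists (S : fin_solution) (phi : Z3 -> S), presents R phi /\ #|S| = #|C|.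
Proof.
have [g gK] := choice f_surj.
have fD P Q V W : f P = f Q -> f V = f W -> f (P + V) = f (Q + W).
  move=> /f_ker h1 h2; transitivity (f (Q + V)).
    by apply/f_ker; rewrite opprD addrACA subrr addr0.
  by apply/f_ker; rewrite opprD addrACA subrr add0r; apply/f_ker.
have flam P Q : f P = f Q -> f (lam P) = f (lam Q).
  by move=> /f_ker /(R_lam Q) h; apply/f_ker; move: h; rewrite [Q + _]addrC subrK.
have fN P Q : f P = f Q -> f (- P) = f (- Q).
  by move=> /esym/f_ker h; apply/f_ker; rewrite opprK addrC.
pose r (ab : C * C) : C * C :=
  (f (g ab.2 + lam (g ab.1)), f (g ab.1 - lam (g ab.2 + lam (g ab.1)))).
have rE P Q : r (f P, f Q) = (f (Q + lam P), f (P - lam (Q + lam P))).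
  rewrite /r /=; have e1 := flam _ _ (gK (f P)).
  have e2 := fD _ _ _ _ (gK (f Q)) e1.
  by congr (_, _) => //; apply: fD (gK (f P)) (fN _ _ (flam _ _ e2)).
clearbody r; have r_inv : involutive r.
  case=> a b; rewrite -(gK a) -(gK b) !rE.
  by rewrite !(subrK, addrK, subKr).
have r_sol : is_solution r.
  split.
  - by constructor; exact: f 0.
  - exact: inv_bij.
  - case=> [[a b] c]; rewrite -(gK a) -(gK b) -(gK c).
    move: (g a) (g b) (g c) => x y z.
    do 3 rewrite /r_id /id_r /= ?rE /=.
    set a' := y + lam x; set b' := x - lam a'; set c' := z + lam y.
    (* The equations [e], [e2] and [e3] settle the three components of the braid equation; each
       comes from [lam_cocycle]. *)
    have e : z + lam b' + lam a' = c' + lam x.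
      have := lam_cocycle x a'; rewrite addrK => /esym/eqP; rewrite addrC => /eqP e.
      by rewrite -addrA e [lam x + _]addrC addrA.
    have e2 : a' - lam (c' + lam x) = y - lam c' + lam (x - lam (c' + lam x)).
      have := lam_cocycle x (c' + lam x); rewrite addrK => e2.
      rewrite [lam (x - _)](canRL (addKr _) (esym e2)) [- _ + _]addrC.
      by rewrite addrA [lam x + _]addrC addrA subrK.
    have e3 : lam a' + lam (z + lam b') = lam (c' + lam x) + lam (a' - lam (c' + lam x)).
      by rewrite -e -[z + lam b' in LHS](addrK (lam a')) lam_cocycle.
    by rewrite e -e2 -[b' - _]addrA -opprD e3 opprD addrA.
  - move=> a; apply: injF_bij => b c; rewrite -(gK a) -(gK b) -(gK c) /sigma !rE /=.
    move=> h; have := fD _ _ _ _ h (erefl (f (- lam (g a)))).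
    by rewrite !addrK !gK.
  - move=> b; apply: surj_bij => a; rewrite -(gK a) -(gK b).
    move: (g a) (g b) => W Q.
    (* The witness inverts [tau_lamE]: the preimage has first coordinate [W.1.1 + 1], and this is
       the value that enters the third coordinate. *)
    exists (f (W + (1, Q.1.1 + 1, tri (Q.1.1 + 1) + Q.1.2 + W.1.1 + 1))).
    rewrite /tau rE /= tau_lamE; congr f.
    by rewrite !Z3E; apply: Z3P => /=; ring.
exists (FinSolution r_sol), f; split=> //; by split.
Qed.

End QuotientSolution.

(** * Quotients by admissible lattices and their retractions *)

Section Admissible.

Variables (m1 m2 m3 : nat) (s u v : int).
Hypothesis adm : admissible m1 m2 m3 s u.
Local Notation L := (lattice m1 m2 m3 s u v).

Lemma admissible_gt0 : [/\ (0 < m1)%N, (0 < m2)%N & (0 < m3)%N].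
Proof. by case: adm => m3_gt0 [k [j [w [j0 k0 -> -> _]]]]; rewrite !muln_gt0 k0 j0. Qed.

Lemma lattice_lam P V : L V -> L (lam (P + V) - lam P).
Proof.
case: adm => _ [k [j [w [_ _ em2 em1 eu]]]] [q [q' [q'' ->]]].
(* The increment has second coordinate [q * m1 = (q * k) * m2]; the choice of [u] makes its third
   coordinate congruent to [- (q * k) * s] modulo [m3]. *)
exists 0, (q * k), (tri (q * k - 1) * (j * m2)%N + P.1.1 * q * k * j + q' * j - q * w).
rewrite /lam !Z3E; apply: Z3P => /=; [by ring | by rewrite em1 PoszM; ring |].
have -> : q * m1 = (q * k) * m2 by rewrite em1 PoszM; ring.
rewrite triD tri_mul [u in LHS]eu; have -> : (m2 : int) = j * m3 by rewrite em2 PoszM.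
by rewrite PoszM em2 PoszM; ring.
Qed.

Lemma lattice_model : exists (S : fin_solution) (phi : Z3 -> S), presents L phi.
Proof.
have [m1_gt0 m2_gt0 m3_gt0] := admissible_gt0.
have [||S [phi [pS _]]] :=
  @quotient_solution _ L (lattice_nf s u v m1_gt0 m2_gt0 m3_gt0) _ _ lattice_lam.
- exact: lattice_nf_surj.
- exact: lattice_nf_ker.
by exists S, phi.
Qed.

(** The left side is the retraction relation. It asks for [x - x' = q' * m2] and for the increment
    of [tri x + y] to be [- q' * s] modulo [m3]. As [tri x - tri x'] is then [q' * tri m2] modulo
    [m3], the second condition bears on [y - y'] and produces [s + tri m2]; [z] is free, whence the
    index 1. *)
Lemma lattice_lamB P Q :
  L (lam P - lam Q) <-> lattice m2 m3 1 0 (s + tri m2) 0 (P - Q).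
Proof.
have [m1_gt0 m2_gt0 m3_gt0] := admissible_gt0.
case: adm => _ [k [j [w [_ _ em2 em1 eu]]]].
have em2' : (m2 : int) = j%:Z * m3%:Z by rewrite em2 PoszM.
case: P Q => [[x y] z] [[x' y'] z']; rewrite /lam !Z3E /=.
split=> [[q [q' [q'' [e1 e2 e3]]]] | [q [q' [q'' [e1 e2 _]]]]].
  have q0 : q = 0.
    by move/eqP: e1; rewrite subrr eq_sym mulf_eq0 => /orP[/eqP // | /eqP[e]]; rewrite e in m1_gt0.
  move: e2 e3; rewrite q0 !mul0r !subr0 => e2 e3.
  exists q', (q'' - tri (q' - 1) * j * m2 - x' * q' * j), (z - z').
  have ex : x = x' + q' * m2 by rewrite -e2 addrC subrK.
  have ey : y - y' = q'' * m3 - q' * s - (tri x - tri x') by rewrite -e3; ring.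
  apply: Z3P => /=; [exact: e2 | rewrite ey ex triD tri_mul | by ring].
  by rewrite em2'; ring.
have ex : x = x' + q * m2 by rewrite -e1 addrC subrK.
exists 0, q, (q' + tri (q - 1) * j * m2 + x' * q * j).
apply: Z3P => /=; [by ring | by rewrite ex; ring |].
have -> : tri x + y - (tri x' + y') = (tri x - tri x') + (y - y') by ring.
by rewrite e2 ex triD tri_mul em2'; ring.
Qed.

Lemma admissible_ret : admissible m2 m3 1 0 (s + tri m2).
Proof.
case: adm => m3_gt0 [k [j [w [j0 k0 em2 em1 eu]]]].
by split=> //; exists j, m3, (s + tri m2 - j%:Z * tri m3); split; rewrite ?muln1 //; ring.
Qed.

Lemma presents_ret (S : fin_solution) (phi : Z3 -> S) : presents L phi ->
  presents (lattice m2 m3 1 0 (s + tri m2) 0) (S := Ret S) (fun P => ret_class (phi P)).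
Proof.
move=> pS; split.
- move=> a; have [P hP] := pres_surj pS (generic_quotient.repr (a : ret_type S)); exists P.
  by rewrite hP ret_class_repr.
- move=> P Q; split.
    move=> /eqP/ret_classP[h _]; apply/lattice_lamB/(pres_ker pS).
    by have := h (phi 0); rewrite !(pres_sigma pS) !add0r.
  move=> h; apply/eqP/ret_classP; split=> a; have [W <-] := pres_surj pS a.
    rewrite !(pres_sigma pS) ![W + _]addrC; apply: (presD pS).
    exact/(pres_ker pS)/lattice_lamB.
  (* Equality of the tau's comes from that of the sigma's: by [lattice_lamB] the relation depends on
     [P - Q] only, so both points may be shifted by [lam W]. *)
  rewrite !(pres_tau pS); apply/esym/(pres_ker pS).
  rewrite [X in L X](_ : _ = lam (P + lam W) - lam (Q + lam W)); last first.
    by rewrite opprB [LHS]addrC addrA subrK.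
  by apply/lattice_lamB; rewrite opprD addrACA subrr addr0.
- by move=> P Q; rewrite /= ret_mapE (pres_map pS).
Qed.

End Admissible.

(** * Vanishing of the third retraction forces the quadratic formula *)

Lemma addrDB3 (V : zmodType) (x y z x' y' z' : V) :
  x + y + z - (x' + y' + z') = (x - x') + (y - y') + (z - z').
Proof. by rewrite opprD addrACA opprD [X in X + _]addrACA. Qed.

Section LevelThree.

Variables (V : zmodType) (l : V -> V).
Hypothesis l_cocycle : forall x y, l x + l (y - l x) = l y + l (x - l y).

(** [H1] is the group of periods of [l], and [H2] consists of the elements along which [l] changes
    by periods. They model the kernels of the projections of [V] to the first and second
    retractions. *)
Let H1 h := forall x, l (x + h) = l x.
Let H2 h := forall x, H1 (l (x + h) - l x).
Hypothesis l_level3 : forall x y, H2 (l x - l y).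
Hypothesis l_generates : forall T : V -> Prop,
  (forall x y, T x -> T y -> T (x - y)) -> (forall x, T (l x)) -> forall x, T x.

Let H1B x y : H1 x -> H1 y -> H1 (x - y).
Proof. by move=> hx hy z; rewrite -(hy (z + _)) addrA subrK hx. Qed.

Let H1_0 : H1 0. Proof. by move=> z; rewrite addr0. Qed.

Let H1N x : H1 x -> H1 (- x).
Proof. by rewrite -sub0r; apply: H1B. Qed.

Let H1D x y : H1 x -> H1 y -> H1 (x + y).
Proof. by move=> hx /H1N hy; rewrite -[y]opprK; apply: H1B. Qed.

Let H2N x : H2 x -> H2 (- x).
Proof. by move=> hx z; have /H1N := hx (z - x); rewrite subrK opprB. Qed.

Let H2D x y : H2 x -> H2 y -> H2 (x + y).
Proof.
move=> hx hy z; have := H1D (hy (z + x)) (hx z).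
by rewrite addrA subrK addrA.
Qed.

Let H12 x : H1 x -> H2 x.
Proof. by move=> hx z; rewrite hx subrr. Qed.

Let H1z x n : H1 x -> H1 (x *~ n).
Proof.
move=> hx; elim: n => [|n IHn|n IHn]; first by rewrite mulr0z.
  by rewrite mulrzS; apply: H1D.
by rewrite mulrzSN; apply: H1B.
Qed.

(* As l (g + h) - l g lies in H1, the cocycle identities for g and g + h show that
   this increment does not change when g is translated by any l k. *)
Let beta_const h g g' : H2 h -> l (g + h) - l g = l (g' + h) - l g'.
Proof.
move=> Hh; pose T k := forall x, l (x + k + h) - l (x + k) = l (x + h) - l x.
suff Tall k : T k by have := Tall (g - g') g'; rewrite [g' + _]addrC subrK.
apply: l_generates k => [x y hx hy z | k z].
  by rewrite addrA -(hy (z + x - y)) subrK hx.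
have e0 := l_cocycle (z + l k) k; rewrite addrK in e0.
have e1 := l_cocycle (z + l k + h) k; rewrite [_ + h - _]addrAC addrK in e1.
have e2 : l (k - l (z + l k + h)) = l (k - l (z + l k)).
  by rewrite -(Hh (z + l k)); congr l; rewrite addrA subrK.
rewrite e2 in e1.
rewrite -[X in X - _](addrK (l (k - l (z + l k)))) -[X in _ - X](addrK (l (k - l (z + l k)))).
by rewrite e1 e0 opprB addrA subrK opprD addrACA subrr add0r.
Qed.

Let lD g h : H2 h -> l (g + h) = l g + (l h - l 0).
Proof. by move=> Hh; have := beta_const g 0 Hh; rewrite add0r => <-; rewrite [RHS]addrC subrK. Qed.

Let lDz g h n : H2 h -> l (g + h *~ n) = l g + (l h - l 0) *~ n.
Proof.
move=> Hh; elim: n => [|n IHn|n IHn]; first by rewrite !mulr0z !addr0.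
  by rewrite !mulrzS [in LHS]addrA lD // IHn -addrA.
rewrite !mulrzSN [RHS]addrA -IHn; set D := l h - l 0.
by rewrite -[in RHS](subrK h (g + _)) lD // -/D addrK addrA.
Qed.

Lemma level3_formula : exists c b : V,
  (forall x y z : int,
     l (l 0 *~ x + c *~ y + b *~ z) = l 0 + c *~ x + b *~ (tri x + y)) /\
  (forall v, exists x y z : int, v = l 0 *~ x + c *~ y + b *~ z).
Proof.
(* In the universal solution [e], [d], [b], [c] are [(1, 0, 0)], [(0, 1, 1)], [(0, 0, 1)],
   [(0, 1, 0)]. *)
pose e := l 0; pose d := l e - e; pose b := l d - e; pose c := d - b.
have Hd : H2 d by apply: l_level3.
have Hb : H1 b by rewrite /b -[d]add0r; apply: Hd.
have Hc : H2 c by apply/H2D/H2N/H12.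
have lc : l c - e = b by rewrite /c H1N.
have ld : l d - e = b by [].
have step g : l g = e + l (g - e) - l (- l g).
  by have := l_cocycle g 0; rewrite sub0r => <-; rewrite addrK.
have dE : d = e - l (- l e).
  by rewrite /d {1}(step e) subrr -/e addrAC addrK.
have cdef : c = d - b by [].
have le_d g : H2 (l g - e) by apply: l_level3.
clearbody d b c.
(* Modulo periods, a shift by [e] adds [d]. This determines [l (e *~ x)] up to periods, which is
   enough to compute [l (- l (e *~ x))] exactly; feeding that back into [step] gives the recursion
   [rec], whose solution is quadratic. *)
have stepH1 g : H1 (l (g + e) - l g - d).
  have -> : l (g + e) - l g - d = l (- l e) - l (- l (g + e)).
    rewrite {1}(step (g + e)) addrK [_ - l g]addrAC addrK dE opprB.
    by rewrite [LHS]addrC addrA subrK.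
  have := l_level3 (g + e) e (- l (g + e)).
  by rewrite addrA addNr add0r.
have lex x : H1 (l (e *~ x) - (e + d *~ x)).
  elim: x => [|n IHn|n IHn]; first by rewrite !mulr0z addr0 subrr.
    have := H1D (stepH1 (e *~ n)) IHn; rewrite !mulrzS; congr H1.
    by rewrite [_ - l (e *~ n) - d]addrAC addrA subrK -addrA -opprD [d + _]addrC -[in LHS]addrA.
  have := H1B IHn (stepH1 (e *~ (- n%:Z) - e)); rewrite subrK !mulrzSN; congr H1.
  move: (l (e *~ (- n%:Z))) (l (e *~ (- n%:Z) - e)) (d *~ (- n%:Z)) => A B D.
  rewrite -[A - B - d]addrA -[- B - d]opprD [- (A - _)]opprB [LHS]addrC addrA subrK.
  by rewrite [e + (D - d)]addrA opprB -[LHS]addrA.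
have lNlex x : l (- l (e *~ x)) = l (- e) - b *~ x.
  have := H1N (lex x) (- (e + d *~ x)); rewrite -opprD addrC subrK => ->.
  by rewrite opprD -mulrNz lDz // -/e ld mulrNz.
have cE : c = e - l (- e).
  by have := lNlex 1; rewrite cdef dE !mulr1z => ->; rewrite opprB addrA addrAC addrK.
have rec x : l (e *~ x) = l (e *~ (x - 1)) + (c + b *~ x).
  rewrite {1}(step (e *~ x)) lNlex cE mulrzBr mulr1z opprB.
  by rewrite [e + l _]addrC -addrA [b *~ x - _]addrC [e + (_ + _)]addrA.
have triS x : tri (x + 1) = tri x + (x + 1).
  by rewrite triD tri1 mulr1 -addrA [1 + x]addrC.
have lexE x : l (e *~ x) = e + c *~ x + b *~ tri x.
  elim: x => [|n IHn|n IHn]; first by rewrite !mulr0z !addr0.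
    have -> : n.+1%:Z = n%:Z + 1 by rewrite -addn1.
    by rewrite rec addrK IHn addrACA -mulrzDr -triS [c *~ (_ + 1)]mulrzDr addrA.
  have -> : - n.+1%:Z = - n%:Z - 1 by rewrite -addn1 PoszD opprD.
  apply: (addIr (c + b *~ (- n%:Z))); rewrite -rec IHn addrACA -mulrzDr.
  rewrite -[X in _ + b *~ (_ + X)](subrK 1) -triS subrK.
  by rewrite [c *~ (_ - 1)]mulrzBr -[e + _ + c]addrA subrK.
have lE x y z : l (e *~ x + c *~ y + b *~ z) = e + c *~ x + b *~ (tri x + y).
  by rewrite H1z // lDz // -/e lc lexE mulrzDr addrA.
exists c, b; split=> // v.
(* Spanning is shown modulo [H2], then modulo [H1], then exactly; each pass applies [l] to the
   description of [g] found by the previous one. *)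
have span2 g : exists x h, H2 h /\ g = e *~ x + h.
  move: g; apply: l_generates => [_ _ [x [h [Hh ->]]] [x' [h' [Hh' ->]]] | g].
    exists (x - x'), (h - h'); split; first exact/H2D/H2N.
    by rewrite mulrzBr opprD addrACA.
  by exists 1, (l g - e); split; [apply: l_level3 | rewrite mulr1z addrC subrK].
have span1 g : exists x y h, H1 h /\ g = e *~ x + d *~ y + h.
  move: g; apply: l_generates => [_ _ [x [y [h [Hh ->]]]] [x' [y' [h' [Hh' ->]]]] | g].
    exists (x - x'), (y - y'), (h - h'); split; first exact/H1B.
    by rewrite [LHS]addrDB3 -!mulrzBr.
  have [x [h [Hh ->]]] := span2 g.
  exists 1, x, (l (e *~ x + h) - (e + d *~ x)); split; last by rewrite mulr1z [RHS]addrC subrK.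
  have := H1D (Hh (e *~ x)) (lex x); by rewrite addrA subrK.
move: v; apply: l_generates => [_ _ [x [y [z ->]]] [x' [y' [z' ->]]] | g].
  exists (x - x'), (y - y'), (z - z').
  by rewrite [LHS]addrDB3 -!mulrzBr.
have [x [y [h [Hh ->]]]] := span1 g.
exists 1, x, (tri x + y); by rewrite Hh lDz // lexE mulr1z mulrzDr -/e ld addrA.
Qed.

End LevelThree.

(** * Abelian groups in additive notation, and Hermite forms *)

Section AdditiveGroup.

Variables (gT : finGroupType) (G : {group gT}).

(** The proof of commutativity is a parameter of the type, so that a [zmodType] instance can be
    attached to it. *)
Definition additive_group of abelian G : Type := subg_of G.

Variable abG : abelian G.
Local Notation V := (additive_group abG).

HB.instance Definition _ := Finite.copy V (subg_of G).

Let mulC (x y : subg_of G) : (x * y = y * x)%g.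
Proof.
apply: val_inj; have := centsP abG _ (subgP x) _ (subgP y).
by [].
Qed.

HB.instance Definition _ := GRing.isZmodule.Build V
  (@mulgA (subg_of G)) mulC (@mul1g (subg_of G)) (@mulVg (subg_of G)).

End AdditiveGroup.

Lemma additive_group_exists (gT : finGroupType) (G : {group gT}) : abelian G ->
  exists (V : zmodType) (i : V -> gT), [/\ injective i, forall x, i x \in G,
    forall g, g \in G -> exists x, i x = g, forall x y, i (x + y) = (i x * i y)%g &
    exists2 n, (0 < n)%N & forall x : V, x *+ n = 0].
Proof.
move=> abG; pose V : zmodType := additive_group abG.
pose i (x : V) := sgval (x : subg_of G).
have iD x y : i (x + y) = (i x * i y)%g by [].
have i0 : i 0 = 1%g by [].
have i_inj : injective i by exact: val_inj.
exists V, i; split=> // [x | g gG |]; first exact: subgP.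
  by exists (subg G g); rewrite /i subgK.
exists #|G| => // x; apply: i_inj; rewrite i0.
have iX n : i (x *+ n) = (i x ^+ n)%g.
  by elim: n => // n IHn; rewrite mulrS iD IHn expgS.
have /dvdnP[k ->] := order_dvdG (subgP x).
by rewrite iX mulnC expgM expg_order expg1n.
Qed.

(** Each index is the least positive element of a subgroup of Z: the last coordinates of elements
    [(0, 0, z)] of [R], the middle ones of elements [(0, y, _)], and all first coordinates. The
    exponent [n] makes these subgroups nonzero. *)
Lemma hermite_form (R : Z3 -> Prop) (n : nat) : (0 < n)%N ->
    (forall P Q, R P -> R Q -> R (P - Q)) -> (forall P, R (P *~ n)) ->
  exists (m1 m2 m3 : nat) (s u v : int),
    [/\ (0 < m1)%N, (0 < m2)%N, (0 < m3)%N &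
        forall P, R P <-> lattice m1 m2 m3 s u v P].
Proof.
move=> n_gt0 RB Rn.
have R0 : R 0 by rewrite -(subrr (0 *~ n)); apply: RB.
have RN P : R P -> R (- P) by rewrite -sub0r; apply: RB.
have RD P Q : R P -> R Q -> R (P + Q) by move=> hP /RN hQ; rewrite -[Q]opprK; apply: RB.
have Rz P (k : int) : R P -> R (P *~ k).
  move=> hP; elim: k => [|k IHk|k IHk]; first by rewrite mulr0z.
    by rewrite mulrzS; apply: RD.
  by rewrite mulrzSN; apply: RB.
have minimal (T : int -> Prop) : T n%:Z -> (forall a b, T a -> T b -> T (a - b)) ->
    exists m : nat, [/\ (0 < m)%N, T m%:Z & forall a, T a -> exists q : int, a = q * m%:Z].
  move=> Tn TB; have T0 : T 0 by rewrite -(subrr n%:Z); apply: TB.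
  have TN a : T a -> T (- a) by rewrite -sub0r; apply: TB.
  have TM a (k : int) : T a -> T (k * a).
    move=> ha; elim: k => [|k IHk|k IHk]; first by rewrite mul0r.
      by rewrite -addn1 PoszD mulrDl mul1r -[a in _ + a]opprK; apply/TB/TN.
    by rewrite -addn1 PoszD opprD mulrBl mul1r; apply: TB.
  have ex : exists m, (0 < m)%N && `[< T m%:Z >] by exists n; rewrite n_gt0; apply/asboolP.
  case: (ex_minnP ex) => m /andP[m_gt0 /asboolP Tm] min_m.
  exists m; split=> // a Ta; exists (a %/ m)%Z.
  have e := divz_eq a m; suff r0 : (a %% m)%Z = 0 by rewrite {1}e r0 addr0.
  have Tr : T (a %% m)%Z.
    have -> : (a %% m)%Z = a - (a %/ m)%Z * m%:Z by rewrite {2}e addrC addKr.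
    exact/TB/TM.
  apply/eqP/negPn/negP => r0; have := min_m `|(a %% m)%Z|%N.
  rewrite absz_gt0 r0 /=; have -> : `|(a %% m)%Z|%N%:Z = (a %% m)%Z by lia.
  by move=> /(_ (asboolT Tr)); lia.
have zE (P : Z3) (k : int) : P *~ k = (P.1.1 * k, P.1.2 * k, P.2 * k).
  case: P => [[a b] c]; elim: k => [|k IHk|k IHk].
  - by rewrite mulr0z !mulr0.
  - by rewrite mulrzS IHk !Z3E; apply: Z3P => /=; ring.
  - by rewrite mulrzSN IHk !Z3E; apply: Z3P => /=; ring.
have [m3 [m3_gt0 T3 min3]] : exists m : nat, [/\ (0 < m)%N, R (0, 0, m%:Z) &
    forall z, R (0, 0, z) -> exists q : int, z = q * m%:Z].
  apply: minimal => [|a b ha hb].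
    by have := Rn (0, 0, 1); rewrite zE /= !mul0r mul1r.
  by have := RB _ _ ha hb; rewrite !Z3E /= subrr.
have [m2 [m2_gt0 [s T2] min2]] : exists m : nat, [/\ (0 < m)%N,
    exists s, R (0, m%:Z, - s) &
    forall y, (exists s, R (0, y, - s)) -> exists q : int, y = q * m%:Z].
  apply: (minimal (fun y => exists s, R (0, y, - s))) => [|a b [s ha] [s' hb]].
    by exists 0; have := Rn (0, 1, 0); rewrite zE /= !mul0r mul1r oppr0.
  exists (s - s'); have := RB _ _ ha hb; rewrite !Z3E /=.
  by congr R; apply: Z3P => /=; ring.
have [m1 [m1_gt0 [u [v T1]] min1]] : exists m : nat, [/\ (0 < m)%N,
    exists u v, R (m%:Z, - u, - v) &
    forall x, (exists u v, R (x, - u, - v)) -> exists q : int, x = q * m%:Z].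
  apply: (minimal (fun x => exists u v, R (x, - u, - v))) => [|a b [u [v ha]] [u' [v' hb]]].
    by exists 0, 0; have := Rn (1, 0, 0); rewrite zE /= !mul0r mul1r oppr0.
  exists (u - u'), (v - v'); have := RB _ _ ha hb; rewrite !Z3E /=.
  by congr R; apply: Z3P => /=; ring.
exists m1, m2, m3, s, u, v; split=> // -[[x y] z]; split=> [hP | [q [q' [q'' ->]]]].
  have [q eq] : exists q : int, x = q * m1%:Z.
    by apply: min1; exists (- y), (- z); rewrite !opprK.
  have h1 := RB _ _ hP (Rz _ q T1).
  rewrite zE !Z3E /= in h1.
  have [q' eq'] : exists q' : int, y + q * u = q' * m2%:Z.
    apply: min2; exists (- z - q * v); move: h1; congr R; rewrite eq.
    by apply: Z3P => /=; ring.
  have h2 := RB _ _ h1 (Rz _ q' T2); rewrite zE !Z3E /= in h2.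
  have [q'' eq''] : exists q'' : int, z + q * v + q' * s = q'' * m3%:Z.
    apply: min3; move: h2; congr R; rewrite eq.
    have ey : y = q' * m2 - q * u by rewrite -eq' addrK.
    by rewrite ey; apply: Z3P => /=; ring.
  exists q, q', q''; apply: Z3P => //=; first by rewrite -eq' addrK.
  by rewrite -eq''; ring.
have := RD _ _ (RD _ _ (Rz _ q T1) (Rz _ q' T2)) (Rz _ q'' T3).
by rewrite !zE !Z3E /=; congr R; apply: Z3P => /=; ring.
Qed.

Lemma pos_quotient (m n : nat) (q : int) : (0 < m)%N -> (0 < n)%N -> m%:Z = q * n%:Z ->
  exists2 k : nat, (0 < k)%N & q = k /\ m = (k * n)%N.
Proof.
move=> m0 n0 e; have q0 : 0 < q by nia.
exists `|q|%N; first by lia.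
by split; [lia | apply/eqP; rewrite -eqz_nat PoszM e; apply/eqP; congr (_ * _); lia].
Qed.

(** Invariance is tested at the base point [0] on two generators. Along [(0, m2, -s)] the increment
    of [lam] is [(0, 0, m2)], so [m3] divides [m2]. Along [(m1, -u, -v)] it is
    [(0, m1, tri m1 - u)], so [m2] divides [m1], and [tri_mul] yields the congruence for [u]. *)
Lemma invariant_lattice_admissible (m1 m2 m3 : nat) (s u v : int) :
    (0 < m1)%N -> (0 < m2)%N -> (0 < m3)%N ->
    (forall P V, lattice m1 m2 m3 s u v V -> lattice m1 m2 m3 s u v (lam (P + V) - lam P)) ->
  admissible m1 m2 m3 s u.
Proof.
move=> m1_gt0 m2_gt0 m3_gt0 inv.
have zero (m : nat) (q : int) : (0 < m)%N -> 0 = q * m%:Z -> q = 0 by nia.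
have incr P : lam (0 + P) - lam 0 = (0, P.1.1, tri P.1.1 + P.1.2).
  by rewrite /lam !Z3E; apply: Z3P => /=; rewrite ?add0r ?subr0 // tri0; ring.
have /(inv 0) : lattice m1 m2 m3 s u v (0, m2%:Z, - s).
  by exists 0, 1, 0; apply: Z3P => /=; ring.
rewrite incr /= tri0 add0r => -[q [q' [q'' [/zero q0 e2 e3]]]].
move: e2 e3; rewrite q0 // !mul0r !subr0 => /zero q'0; rewrite q'0 // mul0r subr0.
move=> /(pos_quotient m2_gt0 m3_gt0)[j j_gt0 [_ em2]].
have /(inv 0) : lattice m1 m2 m3 s u v (m1%:Z, - u, - v).
  by exists 1, 0, 0; apply: Z3P => /=; ring.
rewrite incr /= => -[p [p' [p'' [/zero p0 e2 e3]]]].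
move: e2 e3; rewrite p0 // !mul0r !subr0.
move=> /(pos_quotient m1_gt0 m2_gt0)[k k_gt0 [-> em1]] e3.
split=> //; exists k, j, (tri (k%:Z - 1) * j * m2 - p''); split=> //.
have -> : u = tri m1 - (p'' * m3 - k%:Z * s) by rewrite -e3 opprD opprK addrA subrr add0r.
by rewrite em1 PoszM tri_mul em2 PoszM; ring.
Qed.

(** * Classification: every solution in question is a lattice quotient *)

Section Classification.

Variable S : fin_solution.
Hypotheses (S_class : indecomposable_involutive_abelian S) (S_level : #|Ret_iter 3 S| = 1%N).

Local Notation r := (@smap S).
Local Notation sg := (sigma r).
Local Notation G := <<[set sigma_perm x | x : S]>>%G.

Let r_inv : involutive_sol S. Proof. by case: S_class. Qed.

Let sigma_sigma_tau x y : sg (sg x y) (tau r y x) = x.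
Proof.
by rewrite {1}/sigma /sigma /tau -surjective_pairing r_inv.
Qed.

Let G_abelian : abelian G.
Proof.
case: S_class => _ _; rewrite !abelian_gen => /centsP h.
apply/centsP=> _ /imsetP[x _ ->] _ /imsetP[y _ ->].
by have [] := h _ (imset_f _ (erefl true : x \in predT)) _ (imset_f _ (erefl true : y \in predT)).
Qed.

(** By involutivity, tau acts at a given point as the inverse of a sigma depending on that point.
    Hence a word in sigma's and tau's can be replaced, factor by factor, by an element of [G] with
    the same value at the given point. *)
Let G_trans x y : exists2 g, g \in G & g x = y.
Proof.
have sigG z : sigma_perm z \in G by apply/mem_gen/imset_f.
have h g : g \in <<[set sigma_perm x | x : S] :|: [set tau_perm x | x : S]>>%g ->
    forall z, exists2 g', g' \in G & g' z = g z.
  case/gen_prodgP=> n [c hc ->] {g}; elim: n c hc => [|n IHn] c hc z.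
    by exists 1%g; rewrite ?group1 // big_ord0.
  have [//| g' g'G e] := IHn (fun i => c (widen_ord (leqnSn n) i)) _ z.
  rewrite big_ord_recr permM -e.
  have : c ord_max \in [set sigma_perm x | x : S] :|: [set tau_perm x | x : S] by apply: hc.
  case/setUP=> /imsetP[w _ ->].
    by exists (g' * sigma_perm w)%g; rewrite ?groupM // permM.
  exists (g' * (sigma_perm (sg (g' z) w))^-1)%g; first by rewrite groupM ?groupV.
  rewrite permM [RHS]permE; apply: (canLR (permK (sigma_perm _))); rewrite permE.
  by rewrite sigma_sigma_tau.
case: S_class => /atransP2 tr _ _.
have [g gG ->] := tr x y (in_setT x) (in_setT y).
exact: h gG x.
Qed.

Let ret_class_sigma (T : fin_solution) (x y : T) : ret_class x = ret_class y ->
  forall z, sigma (@smap T) x z = sigma (@smap T) y z.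
Proof. by move=> /eqP/ret_classP[]. Qed.

Let sigma_ret (T : fin_solution) (x y : T) :
  sigma (@smap (Ret T)) (ret_class x) (ret_class y) = ret_class (sigma (@smap T) x y).
Proof. exact: (congr1 fst (ret_mapE x y)). Qed.

Let ret_class2_sigma (T : fin_solution) (x y : T) :
    ret_class (ret_class x : Ret T) = ret_class (ret_class y : Ret T) ->
  forall z, ret_class (sigma (@smap T) x z) = ret_class (sigma (@smap T) y z).
Proof.
move=> /ret_class_sigma h z; have := h (ret_class z).
by rewrite !sigma_ret.
Qed.

Let ret_class3_sigma (x y z : S) :
  ret_class (ret_class (sg x z) : Ret S) = ret_class (ret_class (sg y z) : Ret S).
Proof.
have e : ret_class (ret_class (ret_class x : Ret S) : Ret (Ret S)) =
    ret_class (ret_class (ret_class y : Ret S) : Ret (Ret S)).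
  by apply: (fintype_le1P _) => //; rewrite S_level.
have := ret_class2_sigma e (ret_class z).
by rewrite !sigma_ret.
Qed.

(** A transitive abelian group acts regularly, so a base point [o] identifies [S] with [V]; [l v] is
    the translation by which sigma of [pt v] acts. With [level3_formula], [S] becomes the quotient
    of Z^3 by the kernel of [lin]. *)
Lemma classification : exists (m1 m2 m3 : nat) (s u v : int) (phi : Z3 -> S),
  admissible m1 m2 m3 s u /\ presents (lattice m1 m2 m3 s u v) phi.
Proof.
have [V [i [i_inj iG iS iD [n n_gt0 nV]]]] := additive_group_exists G_abelian.
have [o] := sol_nonempty (fin_solutionP S).
have sgV x : exists v, i v = sigma_perm x by apply/iS/mem_gen/imset_f.
have [l' l'E] := choice sgV.
pose act v x := i v x; pose pt v := act v o; pose l v := l' (pt v).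
have actD v w x : act v (act w x) = act (v + w) x by rewrite /act addrC iD permM.
have act0 x : act 0 x = x by apply: (@perm_inj _ (i 0)); rewrite -/(act 0 _) actD addr0.
have actK v x : act (- v) (act v x) = x by rewrite actD addNr act0.
have sgE x y : sg x y = act (l' x) y by rewrite /act l'E permE.
have tauE x y : tau r y x = act (- l' (sg x y)) x.
  by rewrite -[X in _ = act _ X](sigma_sigma_tau x y) [sg (sg x y) _]sgE actK.
have pt_surj x : exists v, pt v = x.
  by have [g /iS[v <-]] := G_trans o x; exists v.
(* Elements agreeing at [o] agree everywhere, by commutativity and transitivity. *)
have pt_inj : injective pt.
  move=> v w e; apply: i_inj; apply/permP=> x; have [u <-] := pt_surj x.
  by rewrite -/(act v _) -/(act w _) !actD ![_ + u]addrC -!actD -/(pt v) e.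
have sg_pt v w : sg (pt v) (pt w) = pt (l v + w) by rewrite sgE actD.
have tau_pt v w : tau r (pt w) (pt v) = pt (v - l (l v + w)).
  by rewrite tauE sg_pt actD addrC.
have l_cocycle x y : l x + l (y - l x) = l y + l (x - l y).
  rewrite [l x + _]addrC [l y + _]addrC.
  apply: i_inj; apply/permP=> z; rewrite !iD !permM !l'E !permE.
  have := sigma_braid (pt x) (pt (y - l x)) z.
  by rewrite sg_pt tau_pt [l x + _]addrC subrK => ->.
(* Translation by [l x - l y] preserves classes in the second retraction, by [ret_class3_sigma]. *)
have l_level3 x y z w : l (w + (l (z + (l x - l y)) - l z)) = l w.
  have e2 : ret_class (ret_class (pt (z + (l x - l y))) : Ret S) =
      ret_class (ret_class (pt z) : Ret S).
    have := ret_class3_sigma (pt x) (pt y) (pt (z - l y)).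
    by rewrite !sg_pt [l x + _]addrC [l y + _]addrC subrK -addrA [- _ + _]addrC.
  have /ret_class_sigma e1 := ret_class2_sigma e2 (pt (w - l z)).
  have := e1 (pt 0); rewrite !sg_pt !addr0 => /pt_inj.
  by rewrite addrCA [l z + _]addrC subrK.
have l_generates (T : V -> Prop) :
    (forall x y, T x -> T y -> T (x - y)) -> (forall x, T (l x)) -> forall x, T x.
  move=> TB Tl; have T0 : T 0 by rewrite -(subrr (l 0)); apply: TB.
  have TD x y : T x -> T y -> T (x + y).
    by move=> hx hy; rewrite -[y]opprK -[- y]sub0r; apply/TB/TB.
  (* [H] is a group of permutations containing every [sigma_perm x], so it contains [G]. *)
  pose H := [set g | `[< exists2 v, T v & i v = g >]].
  have i0 : i 0 = 1%g by apply: (mulgI (i 0)); rewrite -iD addr0 mulg1.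
  have gH : group_set H.
    apply/group_setP; split; first by rewrite inE; apply/asboolP; exists 0.
    move=> g h; rewrite !inE => /asboolP[v hv <-] /asboolP[w hw <-].
    by apply/asboolP; exists (v + w); [apply: TD | rewrite iD].
  have GH : G \subset Group gH.
    rewrite gen_subG; apply/subsetP=> _ /imsetP[x _ ->]; rewrite inE.
    have [v <-] := pt_surj x; apply/asboolP; exists (l v) => //; exact: l'E.
  move=> x; have := subsetP GH _ (iG x); rewrite inE => /asboolP[v hv /i_inj <-] //.
have [c [b [lE span]]] := level3_formula l_cocycle l_level3 l_generates.
pose lin (P : Z3) := l 0 *~ P.1.1 + c *~ P.1.2 + b *~ P.2.
have linB P Q : lin (P - Q) = lin P - lin Q.
  by rewrite /lin addrDB3 -!mulrzBr.
have linD P Q : lin (P + Q) = lin P + lin Q.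
  by rewrite -{2}(addrK Q P) linB subrK.
have l_lin P : l (lin P) = lin (lam P) by rewrite /lin lE mulr1z.
pose R P := lin P = 0.
have pS : presents R (fun P => pt (lin P)).
  split=> [a | P Q | P Q].
  - by have [v <-] := pt_surj a; have [x [y [z ->]]] := span v; exists (x, y, z).
  - rewrite /R linB; split=> [/pt_inj -> | /eqP]; first by rewrite subrr.
    by rewrite subr_eq0 => /eqP ->.
  - rewrite [LHS]surjective_pairing -[_.1]/(sg _ _) -[_.2]/(tau r _ _).
    by rewrite sg_pt tau_pt l_lin -linD [lam P + Q]addrC l_lin -linB.
have RB P Q : R P -> R Q -> R (P - Q) by exact: (@pres_relB R S _ pS P Q).
have Rn P : R (P *~ n).
  have lin0 : lin 0 = 0 by have := linB 0 0; rewrite !subrr.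
  suff linz k : lin (P *~ k%:Z) = lin P *+ k by rewrite /R linz nV.
  by elim: k => [|k IHk]; rewrite ?mulr0z // mulrzS mulrSr linD IHk.
have [m1 [m2 [m3 [s [u [v [m1_gt0 m2_gt0 m3_gt0 RE]]]]]]] := hermite_form n_gt0 RB Rn.
exists m1, m2, m3, s, u, v, (fun P => pt (lin P)); split.
  apply: (invariant_lattice_admissible (v := v)) => // P W /RE h.
  exact/RE/(pres_rel_lam pS).
split=> [a | P Q | P Q]; [exact: (pres_surj pS) | | exact: (pres_map pS)].
by apply: (iff_trans (pres_ker pS P Q)).
Qed.

End Classification.

(** * Sizes of the iterated retractions *)

Section Sizes.

Variables (m1 m2 m3 : nat) (s u v : int) (S : fin_solution) (phi : Z3 -> S).
Hypotheses (adm : admissible m1 m2 m3 s u) (pS : presents (lattice m1 m2 m3 s u v) phi).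

(** Each retraction turns the indices [(m1, m2, m3)] into [(m2, m3, 1)], so three of them lead to
    [(1, 1, 1)]. *)
Lemma presents_sizes : [/\ #|S| = (m1 * m2 * m3)%N, #|Ret_iter 1 S| = (m2 * m3)%N,
  #|Ret_iter 2 S| = m3 & #|Ret_iter 3 S| = 1%N].
Proof.
have card m1' m2' m3' s' u' v' (T : fin_solution) (psi : Z3 -> T) :
    admissible m1' m2' m3' s' u' -> presents (lattice m1' m2' m3' s' u' v') psi ->
    #|T| = (m1' * m2' * m3')%N.
  by move=> a; have [h1 h2 h3] := admissible_gt0 a; apply: presents_card.
have a1 := admissible_ret adm; have p1 := presents_ret adm pS.
have a2 := admissible_ret a1; have p2 := presents_ret a1 p1.
have a3 := admissible_ret a2; have p3 := presents_ret a2 p2.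
split; first exact: (card _ _ _ _ _ _ _ _ adm pS).
- by rewrite (card _ _ _ _ _ _ _ _ a1 p1) muln1.
- by rewrite (card _ _ _ _ _ _ _ _ a2 p2) !muln1.
- by rewrite (card _ _ _ _ _ _ _ _ a3 p3).
Qed.

Lemma presents_AbSol : AbSol m1 m2 m3 S.
Proof.
have [c0 c1 c2 c3] := presents_sizes.
have [m1_gt0 m2_gt0 m3_gt0] := admissible_gt0 adm.
have nz (m : nat) : (0 < m)%N -> m%:R != 0 :> rat by move=> ?; rewrite pnatr_eq0 -lt0n.
split=> //; first exact: pres_class pS.
- by rewrite /ret_ratio c0 c1 -mulnA natrM mulfK // nz // muln_gt0 m2_gt0.
- by rewrite /ret_ratio c1 c2 natrM mulfK // nz.
- by rewrite /ret_ratio c2 c3 divr1.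
Qed.

End Sizes.

Lemma AbSol_presents (m1 m2 m3 : nat) (S : fin_solution) : AbSol m1 m2 m3 S ->
  exists (s u v : int) (phi : Z3 -> S),
    admissible m1 m2 m3 s u /\ presents (lattice m1 m2 m3 s u v) phi.
Proof.
case=> S_class e1 e2 e3 /(classification S_class).
case=> [n1 [n2 [n3 [s [u [v [phi [adm pS]]]]]]]].
have [_] := presents_AbSol adm pS.
rewrite e1 e2 e3 => /eqP h1 /eqP h2 /eqP h3 _; move: h1 h2 h3.
by rewrite !eqr_nat => /eqP -> /eqP -> /eqP ->; exists s, u, v, phi.
Qed.

(** * Counting isomorphism classes *)

Lemma isomorphic_sym S T : isomorphic S T -> isomorphic T S.
Proof.
case=> f [g fK gK] fM; exists g; first by exists f.
move=> x y; apply: (can_inj (f := fun p => (f p.1, f p.2)) (g := fun p => (g p.1, g p.2))).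
  by case=> a b /=; rewrite !fK.
by rewrite /= !gK -fM !gK; case: smap.
Qed.

Lemma isomorphic_trans T S U : isomorphic S T -> isomorphic T U -> isomorphic S U.
Proof.
move=> [f f_bij fM] [g g_bij gM]; exists (g \o f); first exact: bij_comp.
by move=> x y; rewrite /= gM fM.
Qed.

Lemma has_iso_classes_fin (P : fin_solution -> Prop) (I : finType) (F : I -> fin_solution) :
    (forall i, P (F i)) -> (forall i j, isomorphic (F i) (F j) -> i = j) ->
    (forall S, P S -> exists i, isomorphic S (F i)) ->
  has_iso_classes P #|I|.
Proof.
move=> PF F_inj F_surj; exists (fun i : 'I_#|I| => F (enum_val i)); split=> //.
  by move=> i j /F_inj /enum_val_inj.
by move=> S /F_surj [i hi]; exists (enum_rank i); rewrite enum_rankK.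
Qed.

Lemma has_iso_classes_leq (P : fin_solution -> Prop) k l :
  has_iso_classes P k -> has_iso_classes P l -> (k <= l)%N.
Proof.
move=> [f [Pf f_inj _]] [g [_ _ g_surj]].
have [h hP] := choice (fun i => g_surj _ (Pf i)).
rewrite -(card_ord k) -(card_ord l); apply: (leq_card h) => i j e.
by apply: f_inj; apply: isomorphic_trans (hP i) _; rewrite e; apply: isomorphic_sym.
Qed.

Lemma n_iso_classesE (P : fin_solution -> Prop) k :
  has_iso_classes P k -> n_iso_classes P = k.
Proof.
move=> Pk; apply: (classical_sets.xget_unique 0%N (P := has_iso_classes P) Pk) => l Pl.
by apply/eqP; rewrite eqn_leq !(has_iso_classes_leq (P := P)).
Qed.

Lemma ord_remainder (m : nat) : (0 < m)%N -> forall x : int,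
  exists (a : 'I_m) (q : int), x = q * m%:Z + a%:Z.
Proof.
by move=> m_gt0 x; exists (zord m_gt0 x), (x %/ m)%Z; rewrite {1}(divz_eq x m) /=; lia.
Qed.

(** * Normal forms of admissible lattices under change of base point *)

Section Normalization.

Variables (k j m3 : nat).
Hypotheses (k_gt0 : (0 < k)%N) (j_gt0 : (0 < j)%N) (m3_gt0 : (0 < m3)%N).
Local Notation m2 := (j * m3)%N.
Local Notation m1 := (k * (j * m3))%N.

Definition twist (s w : int) : int := k%:Z * (s + tri m2) + w * m3%:Z.

Local Notation L s w v := (lattice m1 m2 m3 s (twist s w) v).

Lemma twist_admissible s w : admissible m1 m2 m3 s (twist s w).
Proof. by split=> //; exists k, j, w. Qed.

(* A change of the base point to (i, _, _) adds i times this quantity to v. *)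
Lemma twist_slope (s w : int) : k%:Z * s - 2 * twist s w =
  - (k%:Z * s) - (k%:Z * j%:Z * (m2%:Z + 1) + 2 * w) * m3%:Z.
Proof.
have -> : 2 * twist s w = 2 * (k%:Z * s) + k%:Z * (2 * tri m2) + 2 * w * m3%:Z.
  by rewrite /twist; ring.
by rewrite tri_double [m2%:Z in X in _ - (_ + _ * X + _)]PoszM; ring.
Qed.

(** Changing generators reduces [s] modulo [m3] and [w] modulo [j]; a change of base point then
    reduces [v] modulo the gcd of [m3] and [k * s0]. *)
Lemma lattice_normal_form (s w v : int) :
  exists (s0 : 'I_m3) (w0 : 'I_j) (v0 : 'I_m3) (P0 : Z3),
    (v0 < gcdn m3 (k * s0))%N /\
    forall P, L s w v P -> L s0%:Z w0%:Z v0%:Z (rebase P0 P).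
Proof.
have [s0 [q2 es]] := ord_remainder m3_gt0 s.
(* Lowering [s] by [q2 * m3] lowers [k * s] by [k * q2 * m3], which [w] has to absorb. *)
have [w0 [q ew]] := ord_remainder j_gt0 (w + k%:Z * q2).
have g_gt0 : (0 < gcdn m3 (k * s0))%N by rewrite gcdn_gt0 m3_gt0.
(* Removing [q * m2] from [u] means adding [q] times the second generator to the first, which turns
   [v] into [v + q * s]. *)
have [v0' [n ev]] := ord_remainder g_gt0 (v + q * s).
have v0_lt : (v0' < m3)%N by apply: leq_trans (ltn_ord v0') _; rewrite dvdn_leq // dvdn_gcdl.
have [[a b] eg] : exists ab : int * int, (gcdn m3 (k * s0))%:Z =
    ab.1 * m3%:Z + ab.2 * (k * s0)%N%:Z.
  by have [a [b e]] := Bezoutz m3 (k * s0)%N; exists (a, b); rewrite /= e.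
rewrite /= PoszM in eg.
(* With the Bezout coefficient [b], moving the base point by [- n * b] changes [v] by
   [- n * b * k * s0], which is [- n] times the gcd modulo [m3]. *)
exists s0, w0, (Ordinal v0_lt), (- n * b, 0, 0); split; first exact: (ltn_ord v0').
move=> _ [qa [qb [qc ->]]].
have := twist_slope s0%:Z w0%:Z => slope.
have eu : twist s w = twist s0%:Z w0%:Z + q * m2%:Z.
  have ew' : w = q * j%:Z + w0%:Z - k%:Z * q2 by rewrite -ew addrK.
  by rewrite /twist PoszM {1}es ew'; ring.
have ev' : v = n * (gcdn m3 (k * s0))%:Z + v0'%:Z - q * s by rewrite -ev addrK.
rewrite /rebase /=; set u := twist s w in eu *; set u0 := twist _ _ in slope eu *.
exists qa, (qa * (- n * b * k%:Z - q) + qb).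
set Y := k%:Z * j%:Z * (m2%:Z + 1) + 2 * w0%:Z in slope.
exists (tri (- n * b) * qa * k%:Z * j%:Z + 2 * (- n * b) * (qb - qa * q) * j%:Z + qc - qb * q2
  - qa * n * a + qa * n * b * Y + qa * q * q2).
apply: Z3P => /=.
- by [].
- by rewrite eu !PoszM; ring.
have e2 : 2 * u0 = k%:Z * s0%:Z + (k%:Z * s0%:Z + Y * m3%:Z).
  have -> : 2 * u0 = k%:Z * s0%:Z - (k%:Z * s0%:Z - 2 * u0) by ring.
  by rewrite slope; ring.
have -> : 2 * (- n * b) * (qb * m2%:Z - qa * u) =
   2 * (- n * b) * (qb - qa * q) * m2%:Z - qa * (- n * b) * (2 * u0).
  by rewrite eu; ring.
rewrite e2 ev' eg es !PoszM; ring.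
Qed.

(** The image of the second generator gives [s = s']. That of the first gives [w = w'] and shows
    [v - v'] to be an integral combination of [m3] and [k * s], hence a multiple of their gcd, which
    exceeds both [v] and [v']. *)
Lemma normal_form_unique (s s' : 'I_m3) (w w' : 'I_j) (v v' : 'I_m3) (P0 : Z3) :
    (v < gcdn m3 (k * s))%N -> (v' < gcdn m3 (k * s'))%N ->
    (forall P, L s%:Z w%:Z v%:Z P -> L s'%:Z w'%:Z v'%:Z (rebase P0 P)) ->
  [/\ s = s', w = w' & v = v'].
Proof.
move=> v_lt v'_lt h.
have [m1_gt0 m2_gt0 _] := admissible_gt0 (twist_admissible s%:Z w%:Z).
have [qa [qb [qc /= [e1 e2 e3]]]] : L s'%:Z w'%:Z v'%:Z (rebase P0 (0, m2%:Z, - s%:Z)).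
  by apply: h; exists 0, 1, 0; apply: Z3P => /=; ring.
have qa0 : qa = 0 by apply: (@mulIf _ m1%:Z); [lia | rewrite mul0r -e1].
have qb1 : qb = 1.
  by apply: (@mulIf _ m2%:Z); [lia | move: e2; rewrite qa0 mul0r mulr0 subr0 add0r mul1r].
have es : s = s'.
  apply: val_inj => /=; move: e3; rewrite qa0 qb1 => e3.
  have : (2 * P0.1.1 * j%:Z - qc) * m3%:Z = s%:Z - s'%:Z.
    by move: e3; rewrite PoszM => e3; apply/eqP; rewrite -subr_eq0; apply/eqP; lia.
  move=> e; have := mul_small e (ltn_ord _) (ltn_ord _) => z; move: e; rewrite z mul0r; lia.
rewrite -es in h v'_lt *.
have [pa [pb [pc /= [f1 f2 f3]]]] :
    L s%:Z w'%:Z v'%:Z (rebase P0 (m1%:Z, - twist s%:Z w%:Z, - v%:Z)).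
  by apply: h; exists 1, 0, 0; apply: Z3P => /=; ring.
have pa1 : pa = 1 by apply: (@mulIf _ m1%:Z); [lia | rewrite mul1r -f1].
have ew0 : (P0.1.1 * k%:Z - pb) * j%:Z = w%:Z - w'%:Z.
  apply: (@mulIf _ m3%:Z); first by lia.
  by move: f2; rewrite pa1 /twist !PoszM => f2; lia.
have z := mul_small ew0 (ltn_ord _) (ltn_ord _).
have ew : w = w' by apply: val_inj => /=; move: ew0; rewrite z mul0r; lia.
rewrite -ew in f3 *; split=> //; apply: val_inj => /=.
have /dvdnP[a ea] := dvdn_gcdl m3 (k * s); have /dvdnP[b eb] := dvdn_gcdr m3 (k * s).
set g := gcdn _ _ in ea eb v_lt v'_lt.
have slope := twist_slope s%:Z w%:Z.
set Y := k%:Z * j%:Z * (m2%:Z + 1) + 2 * w%:Z in slope.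
have epb : pb = P0.1.1 * k%:Z by lia.
have ev : v%:Z - v'%:Z = ((tri P0.1.1 + P0.1.2) * k%:Z * j%:Z - pc - P0.1.1 * Y) * m3%:Z
   - P0.1.1 * (k * s)%N%:Z.
  move: f3; rewrite pa1 epb; set u := twist _ _ in slope *; rewrite !PoszM => f3.
  have eu : 2 * u = k%:Z * s%:Z - (k%:Z * s%:Z - 2 * u) by ring.
  have ev0 : v%:Z - v'%:Z = (tri P0.1.1 + P0.1.2) * (k%:Z * (j%:Z * m3%:Z)) - P0.1.1 * (2 * u)
    - pc * m3%:Z + P0.1.1 * k%:Z * s%:Z by lia.
  by rewrite ev0 eu slope; ring.
have e : (((tri P0.1.1 + P0.1.2) * k%:Z * j%:Z - pc - P0.1.1 * Y) * a%:Z - P0.1.1 * b%:Z) * g%:Z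
   = v%:Z - v'%:Z.
  by rewrite ev {1}ea {1}eb !PoszM; ring.
have z' := mul_small e v_lt v'_lt; move: e; rewrite z' mul0r; lia.
Qed.

End Normalization.

(** * The number of classes as a sum of gcd's *)

Definition gcd_sum (k m : nat) : nat := (\sum_(s < m) gcdn m (k * s))%N.

(** The classes are indexed by the normal forms [(s, w, v)]: for each [s] there are [j] values of
    [w] and [gcdn m3 (k * s)] values of [v]. *)
Lemma AbSol_classes (k j m3 : nat) : (0 < k)%N -> (0 < j)%N -> (0 < m3)%N ->
  has_iso_classes (AbSol (k * (j * m3)) (j * m3) m3) (j * gcd_sum k m3).
Proof.
move=> k_gt0 j_gt0 m3_gt0.
pose I := {x : 'I_m3 * 'I_j * 'I_m3 | (x.2 < gcdn m3 (k * x.1.1))%N}.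
have -> : (j * gcd_sum k m3)%N = #|{: I}|.
  rewrite card_sig -sum1_card big_mkcond.
  rewrite -(pair_bigA _ (fun (ab : 'I_m3 * 'I_j) (c : 'I_m3) =>
    nat_of_bool (c < gcdn m3 (k * ab.1))%N)).
  rewrite -(pair_bigA _ (fun (a : 'I_m3) (b : 'I_j) =>
    \sum_(c < m3) nat_of_bool (c < gcdn m3 (k * a))%N)%N) /=.
  rewrite /gcd_sum big_distrr; apply: eq_bigr => a _; rewrite sum_nat_const card_ord; congr muln.
  have le_g : (gcdn m3 (k * a) <= m3)%N by rewrite dvdn_leq // dvdn_gcdl.
  by rewrite -big_mkcond (big_ord_narrow le_g) sum1_card card_ord.
have [S SP] := choice (fun x : I =>
  lattice_model (val x).2 (twist_admissible k_gt0 j_gt0 m3_gt0 (val x).1.1 (val x).1.2)).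
apply: (has_iso_classes_fin (F := S)) => [x | x y [f f_bij fM] | T hT].
- by have [phi pS] := SP x; apply: presents_AbSol pS; exact: twist_admissible.
- have [phi pS] := SP x; have [psi pT] := SP y.
  have [P0 hP0] := pres_surj pT (f (phi 0)).
  have h P := (isomorphic_presents pS pT f_bij fM (esym hP0) P).1.
  have [e1 e2 e3] := normal_form_unique k_gt0 j_gt0 m3_gt0 (valP x) (valP y) h.
  apply: val_inj; move: e1 e2 e3.
  by case: (val x) (val y) => [[a b] c] [[a' b'] c'] /= -> -> ->.
- have [s [u [v [phi [adm pT]]]]] := AbSol_presents hT.
  have [w eu] : exists w, u = twist k j m3 s w.
    case: adm => _ [k' [j' [w [j'0 k'0 e2 e1 eu]]]]; exists w; rewrite eu /twist.
    by move/eqP: e1; rewrite eqn_pmul2r ?muln_gt0 ?j_gt0 // => /eqP ->.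
  rewrite eu in pT.
  have [s0 [w0 [v0 [P0 [v0_lt h]]]]] := lattice_normal_form k j_gt0 m3_gt0 s w v.
  pose x : I := exist _ (s0, w0, v0) v0_lt; exists x.
  have [psi pS] := SP x; apply: (presents_isomorphic pT pS _ h).
  have a1 := twist_admissible k_gt0 j_gt0 m3_gt0 s w.
  have a2 := twist_admissible k_gt0 j_gt0 m3_gt0 s0 w0.
  by have [-> _ _ _] := presents_sizes a1 pT; have [-> _ _ _] := presents_sizes a2 pS.
Qed.

(** * Evaluation of the gcd sum at prime powers *)

Lemma sum_ord_mul (F : nat -> nat) (m n : nat) :
  (\sum_(s < m * n) F s = \sum_(a < m) \sum_(b < n) F (a + m * b))%N.
Proof.
elim: n => [|n IHn].
  by rewrite muln0 big_ord0 big1 // => a _; rewrite big_ord0.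
under [RHS]eq_bigr => a _ do rewrite big_ord_recr /=.
rewrite big_split /= -IHn mulnS addnC -!(big_mkord xpredT F).
rewrite (big_cat_nat (n := (m * n)%N)) ?leq_addr //=; congr addn.
rewrite -{1}[(m * n)%N]add0n big_addn addKn big_mkord.
by apply: eq_bigr.
Qed.

Section GcdSum.

Variable p : nat.
Hypothesis p_prime : prime p.

Let p_gt0 : (0 < p)%N. Proof. exact: prime_gt0. Qed.

(** Write [s = a + p ^ n * b]. A factor [p] leaves the gcd, and the rest depends on [a] only, so the
    [p] values of [b] contribute a second factor [p]. *)
Lemma gcd_sumSS (f n : nat) :
  gcd_sum (p ^ f.+1) (p ^ n.+1) = (p ^ 2 * gcd_sum (p ^ f) (p ^ n))%N.
Proof.
rewrite /gcd_sum [in LHS]expnSr (sum_ord_mul (fun s => gcdn (p ^ n * p) (p ^ f.+1 * s))).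
rewrite big_distrr /=; apply: eq_bigr => a _.
rewrite (eq_bigr (fun=> p * gcdn (p ^ n) (p ^ f * a))%N) => [|b _].
  by rewrite sum_nat_const card_ord mulnA.
rewrite mulnC expnS -mulnA -muln_gcdr; congr muln.
by rewrite mulnDr mulnCA [(p ^ n * _)%N]mulnC addnC gcdnMDl.
Qed.

(** Write [s = a + p * b]. For [a] nonzero the gcd is 1; for [a = 0] a factor [p] leaves it. *)
Lemma gcd_sum1S (n : nat) :
  gcd_sum 1 (p ^ n.+1) = (p.-1 * p ^ n + p * gcd_sum 1 (p ^ n))%N.
Proof.
rewrite /gcd_sum [in LHS]expnS (sum_ord_mul (fun s => gcdn (p * p ^ n) (1 * s))).

rewrite (bigD1 (Ordinal p_gt0)) //= addnC; congr addn; last first.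
  rewrite big_distrr /=; apply: eq_bigr => b _.
  by rewrite !mul1n add0n muln_gcdr.
rewrite (eq_bigr (fun=> p ^ n)%N) => [|a a0]; first by rewrite sum_nat_const cardC1 card_ord.
rewrite (eq_bigr (fun=> 1)%N) => [|b _]; first by rewrite sum_nat_const card_ord muln1.
apply/eqP; rewrite -expnS mul1n -/(coprime _ _) coprime_pexpl // prime_coprime //.
by rewrite dvdn_addl ?dvdn_mulr // gtnNdvd // lt0n.
Qed.

Local Open Scope ring_scope.

(** [gcd_sumSS] lowers [f] and [n] together until one of them is 0; [n = 0] is a single term, and
    [f = 0] is solved by the recursion [gcd_sum1S]. *)
Lemma gcd_sum_rat (f n : nat) : (gcd_sum (p ^ f) (p ^ n))%:R =
  (if (f < n)%N then p%:R ^+ (f + n) * (1 + (n%:R - f%:R) * (1 - p%:R^-1))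
   else p%:R ^+ (2 * n)) :> rat.
Proof.
have p0 : p%:R != 0 :> rat by rewrite pnatr_eq0 -lt0n.
elim: f n => [n | f IHf [|n]]; last first.
- have e : n.+1%:R - f.+1%:R = n%:R - f%:R :> rat by rewrite -!natr1; ring.
  rewrite gcd_sumSS natrM IHf ltnS natrX e; case: ifP => _.
    by rewrite addSn addnS !exprS; ring.
  by rewrite mulnS exprD.
- by rewrite expn0 /gcd_sum big_ord1 gcd1n.
have -> : gcd_sum (p ^ 0) (p ^ n) = gcd_sum 1 (p ^ n) by [].
have -> : (gcd_sum 1 (p ^ n))%:R = p%:R ^+ n * (1 + n%:R * (1 - p%:R^-1)) :> rat.
  elim: n => [|n IHn]; first by rewrite expn0 /gcd_sum big_ord1 gcd1n mul0r addr0 mulr1.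
  rewrite gcd_sum1S natrD !natrM IHn natrX -subn1 natrB // exprS -natr1.
  by field.
by case: n => [|n] /=; rewrite ?mul0r ?addr0 ?mulr1 ?muln0 ?subr0.
Qed.

End GcdSum.

(** * Prime power sizes and the final count *)

Lemma AbSol_prime_power_classes p d1 d2 d3 : prime p -> (d3 <= d2)%N -> (d2 <= d1)%N ->
  has_iso_classes (AbSol (p ^ d1) (p ^ d2) (p ^ d3))
    (p ^ (d2 - d3) * gcd_sum (p ^ (d1 - d2)) (p ^ d3)).
Proof.
move=> p_prime d32 d21; have p0 n : (0 < p ^ n)%N by rewrite expn_gt0 prime_gt0.
have e2 : (p ^ d2 = p ^ (d2 - d3) * p ^ d3)%N by rewrite -expnD subnK.
have e1 : (p ^ d1 = p ^ (d1 - d2) * p ^ d2)%N by rewrite -expnD subnK.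
by rewrite e1 e2; apply: AbSol_classes.
Qed.

Lemma AbSol_size p d1 d2 d3 S : prime p -> AbSol (p ^ d1) (p ^ d2) (p ^ d3) S ->
  AbSol_size_mpl_le3 (p ^ (d1 + d2 + d3)) S.
Proof.
move=> p_prime h; have [s [u [v [phi [adm pS]]]]] := AbSol_presents h.
have [c0 c1 c2 c3] := presents_sizes adm pS.
split; first by case: h.
  by rewrite c0 !expnD.
have ex : exists l, #|Ret_iter l S| == 1%N by exists 3; rewrite c3.
exists (ex_minn ex); case: ex_minnP => l /eqP hl min_l.
  by apply: min_l; rewrite c3.
by split=> // k lt_kl e; have := min_l k; rewrite e eqxx leqNgt lt_kl => /(_ isT).
Qed.

Lemma Ret_card1 (S : fin_solution) : #|S| = 1%N -> #|Ret S| = 1%N.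
Proof.
move=> cS; have [x] := sol_nonempty (fin_solutionP S).
apply/eqP; rewrite eqn_leq; apply/andP; split; last first.
  by apply/card_gt0P; exists (ret_class x).
apply/fintype_le1P => a b.
rewrite -(ret_class_repr a) -(ret_class_repr b); congr ret_class.
have /fintype_le1P all_eq : (#|S| <= 1)%N by rewrite cS.
exact: all_eq.
Qed.

(** The indices of the lattice divide [p ^ d], so they are powers of [p]; the divisibilities in
    [admissible] order the exponents. *)
Lemma AbSol_size_presents p d S : prime p -> AbSol_size_mpl_le3 (p ^ d) S ->
  exists d1 d2 d3, [/\ (d3 <= d2)%N, (d2 <= d1)%N, (d1 + d2 + d3 = d)%N &
    AbSol (p ^ d1) (p ^ d2) (p ^ d3) S].
Proof.
move=> p_prime [S_class cS [l l3 [cl _]]].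
have c3 : #|Ret_iter 3 S| = 1%N.
  rewrite -(subnK l3); elim: (3 - l)%N => // n IHn.
  by rewrite addSn; apply: Ret_card1.
have [m1 [m2 [m3 [s [u [v [phi [adm pS]]]]]]]] := classification S_class c3.
have hS := presents_AbSol adm pS.
have [c0 _ _ _] := presents_sizes adm pS; rewrite c0 in cS.
case: adm => m3_gt0 [k [j [w [j0 k0 e2 e1 _]]]].
have m123 : (m1 * m2 * m3 %| p ^ d)%N by rewrite cS.
have /(dvdn_pfactor _ _ p_prime)[d1 _ ed1] : (m1 %| p ^ d)%N.
  by apply: dvdn_trans m123; rewrite -mulnA dvdn_mulr.
have /(dvdn_pfactor _ _ p_prime)[d2 _ ed2] : (m2 %| p ^ d)%N.
  by apply: dvdn_trans m123; rewrite mulnAC dvdn_mull.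
have /(dvdn_pfactor _ _ p_prime)[d3 _ ed3] : (m3 %| p ^ d)%N.
  by apply: dvdn_trans m123; rewrite dvdn_mull.
have p1 := prime_gt1 p_prime.
exists d1, d2, d3; rewrite -ed1 -ed2 -ed3; split=> //.
- by rewrite -(dvdn_Pexp2l _ _ p1) -ed2 -ed3 e2 dvdn_mull.
- by rewrite -(dvdn_Pexp2l _ _ p1) -ed2 -ed1 e1 dvdn_mull.
- by apply/eqP; rewrite -(eqn_exp2l _ _ p1) !expnD -ed1 -ed2 -ed3 cS.
Qed.

Lemma presents_transport (R : Z3 -> Prop) (S T : fin_solution) (phi : Z3 -> S) (f : S -> T) :
    presents R phi -> bijective f ->
    (forall x y, smap (f x, f y) = (f (smap (x, y)).1, f (smap (x, y)).2)) ->
  presents R (fun P => f (phi P)).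
Proof.
move=> pS f_bij fM; split=> [b | P Q | P Q].
- have [g fK gK] := f_bij; have [P hP] := pres_surj pS (g b).
  by exists P; rewrite hP gK.
- by rewrite -(pres_ker pS); split=> [/(bij_inj f_bij) | ->].
- by rewrite fM (pres_map pS).
Qed.

Lemma isomorphic_AbSol m1 m2 m3 S T : isomorphic S T -> AbSol m1 m2 m3 S -> AbSol m1 m2 m3 T.
Proof.
move=> [f f_bij fM] /AbSol_presents[s [u [v [phi [adm pS]]]]].
exact: presents_AbSol adm (presents_transport pS f_bij fM).
Qed.

Lemma AbSol_inj m1 m2 m3 n1 n2 n3 S : AbSol m1 m2 m3 S -> AbSol n1 n2 n3 S ->
  [/\ m1 = n1, m2 = n2 & m3 = n3].
Proof.
case=> _ e1 e2 e3 _ [_]; rewrite e1 e2 e3 => /eqP h1 /eqP h2 /eqP h3 _; move: h1 h2 h3.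
by rewrite !eqr_nat => /eqP -> /eqP -> /eqP ->.
Qed.

Local Close Scope ring_scope.

Theorem theorem7p30 (p : nat) (p_prime : prime p) :
  (forall d1 d2 d3 : nat, d3 <= d2 -> d2 <= d1 ->
    ((n_iso_classes (AbSol (p ^ d1) (p ^ d2) (p ^ d3)))%:R : rat)%R =
      (if (d1 < d2 + d3)%N then
         p%:R ^+ d1 * (1 + (- d1%:R + d2%:R + d3%:R) * (1 - p%:R^-1))
       else p%:R ^+ (d2 + d3)%N)%R) /\
  (forall d : nat,
    n_iso_classes (AbSol_size_mpl_le3 (p ^ d)) =
      \sum_(d1 < d.+1) \sum_(d2 < d.+1)
        \sum_(d3 < d.+1 | [&& d3 <= d2, d2 <= d1 & d1 + d2 + d3 == d])
          n_iso_classes (AbSol (p ^ d1) (p ^ d2) (p ^ d3))).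
Proof.
split=> [d1 d2 d3 d32 d21 | d].
  rewrite (n_iso_classesE (AbSol_prime_power_classes p_prime d32 d21)) natrM gcd_sum_rat //.
  (* With [f = d1 - d2] and [n = d3], the test [f < n] is [d1 < d2 + d3], and the factor
     [p ^ (d2 - d3)] raises the exponents to [d1] and [d2 + d3]. *)
  rewrite ltn_subLR // natrX; case: ifP => _.
    rewrite mulrA -exprD natrB //; congr (_ ^+ _ * (1 + _ * _))%R; last by ring.
    by lia.
  by rewrite -exprD; congr (_ ^+ _)%R; lia.
pose cond (x : 'I_d.+1 * 'I_d.+1 * 'I_d.+1) :=
  [&& x.2 <= x.1.2, x.1.2 <= x.1.1 & x.1.1 + x.1.2 + x.2 == d]%N.
pose P (x : 'I_d.+1 * 'I_d.+1 * 'I_d.+1) := AbSol (p ^ x.1.1) (p ^ x.1.2) (p ^ x.2).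
pose n x := if cond x then n_iso_classes (P x) else 0%N.
(* Triples violating [cond] receive an empty family of classes, so a single dependent sum over all
   triples indexes the representatives. *)
have Pn x : has_iso_classes (fun S => cond x /\ P x S) (n x).
  rewrite /n; case: ifP => [/and3P[c1 c2 _] | _].
    have h := AbSol_prime_power_classes p_prime c1 c2.
    rewrite (n_iso_classesE h); have [s [h1 h2 h3]] := h.
    by exists s; split=> [i | i j | S [_ hS]]; [by split; last exact: h1 | exact: h2 | exact: h3].
  by exists (fun i : 'I_0 => False_rect fin_solution (notF (ltn_ord i))); split=> [[] | [] | S []].
have [s sP] : {s : forall x, 'I_(n x) -> fin_solution & forall x,
   [/\ forall i, cond x /\ P x (s x i), forall i j, isomorphic (s x i) (s x j) -> i = j &
     forall S, cond x /\ P x S -> exists i, isomorphic S (s x i)]}.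
  by exists (fun x => sval (cid (Pn x))) => x; case: cid.
pose I := {x & 'I_(n x)}.
have -> : (\sum_(d1 < d.+1) \sum_(d2 < d.+1)
        \sum_(d3 < d.+1 | [&& d3 <= d2, d2 <= d1 & d1 + d2 + d3 == d])
          n_iso_classes (AbSol (p ^ d1) (p ^ d2) (p ^ d3)) = #|{: I}|)%N.
  rewrite card_tagged sumnE big_map big_enum /= pair_bigA /=.
  under eq_bigr => x _ do rewrite big_mkcond /=.
  rewrite pair_bigA /=; apply: eq_bigr => x _.
  by rewrite card_ord.
apply/n_iso_classesE/(has_iso_classes_fin (F := fun y : I => s (tag y) (tagged y))).
- case=> x i /=; have [/(_ i)[/and3P[_ _ /eqP e] h] _ _] := sP x.
  by rewrite -e; apply: AbSol_size h.
- case=> x i [y j] /= iso.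
  have [/(_ i)[_ hx] inj_x _] := sP x; have [/(_ j)[_ hy] _ _] := sP y.
  (* The ratios of successive retraction sizes are isomorphism invariants, so distinct triples share
     no class. *)
  have [] := AbSol_inj (isomorphic_AbSol iso hx) hy.
  have p1 := prime_gt1 p_prime.
  have expI a b : p ^ a = p ^ b -> a = b by move=> /eqP; rewrite eqn_exp2l // => /eqP.
  move=> /expI e1 /expI e2 /expI e3.
  have exy : x = y.
    by case: x y e1 e2 e3 {i j iso hx hy inj_x} => [[a b] c] [[a' b'] c'] /= e1 e2 e3;
      congr (_, _, _); apply: val_inj.
  by subst y; congr existT; apply: inj_x.
move=> S /(AbSol_size_presents p_prime)[d1 [d2 [d3 [d32 d21 ed h]]]].
have d1d : (d1 < d.+1)%N by lia.
have d2d : (d2 < d.+1)%N by lia.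
have d3d : (d3 < d.+1)%N by lia.
pose x := (Ordinal d1d, Ordinal d2d, Ordinal d3d).
have cx : cond x by rewrite /cond /= d32 d21 ed eqxx.
have [_ _ /(_ S (conj cx h)) [i hi]] := sP x.
by exists (existT _ x i).
Qed.
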